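(* Let $K$ be a field and $c\ge 1$ an integer. Let $\mathbf{M}$ be a finitely generated graded $\mathrm{OI}$-module over $(\mathbf{X}^{\mathrm{OI},1})^{\otimes c}$ or a finitely generated graded $\mathrm{FI}$-module over $(\mathbf{X}^{\mathrm{FI},1})^{\otimes c}$. If $\mathbf{M}$ is generated in non-negative degrees, then the following two conditions are equivalent: (i) $\mathbf{M}$ is Artinian. (ii) The equivariant Hilbert series of $\mathbf{M}$ is of the form \[ H_{\mathbf{M}} (s, t) = \tilde{g} (s, t) + \frac{h(s, t)}{[f_1 (t) \cdots f_b (t)]^e \cdot \prod_{j =1}^b [1 - s \cdot f_j (t)]}, \] where $b, e$ are non-negative integers, $\tilde{g} (s, t) \in \mathbb{Q}(t)[s]$, $h (s, t) \in \mathbb{Z}[s, t]$ is either zero or not divisible by $1-t$ and has degree less than $b$ considered as a polynomial in $s$ (and so $h (s, t) = 0$ if $b = 0$), and each $f_j (t)$ is a polynomial in $\mathbb{Z}[t]$ satisfying $f_j (1) > 0$ and $f_j (0) = 1$.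
   Context: $\mathrm{OI}$ (resp. $\mathrm{FI}$) is the category with objects $[n] = \{1,\dots,n\}$, $n \ge 0$ ($[0]=\emptyset$), and morphisms the strictly increasing (resp. injective) maps $\varepsilon\colon [m]\to[n]$. The $\mathrm{OI}$-algebra $(\mathbf{X}^{\mathrm{OI},1})^{\otimes c}$ (resp. $\mathrm{FI}$-algebra $(\mathbf{X}^{\mathrm{FI},1})^{\otimes c}$) over $K$ is the functor $\mathbf{P}$ from $\mathrm{OI}$ (resp. $\mathrm{FI}$) to commutative $K$-algebras with $\mathbf{P}_n = K[x_{i,j} : 1\le i\le c,\ 1\le j\le n]$ (so $\mathbf{P}_0=K$) and, for $\varepsilon\colon[m]\to[n]$, $\varepsilon_*\colon \mathbf{P}_m\to\mathbf{P}_n$ the $K$-algebra homomorphism with $\varepsilon_*(x_{i,j}) = x_{i,\varepsilon(j)}$. Every variable has degree one. An $\mathrm{OI}$-module (resp. $\mathrm{FI}$-module) $\mathbf{M}$ over $\mathbf{P}$ is a functor from $\mathrm{OI}$ (resp. $\mathrm{FI}$) to $K$-vector spaces such that each $\mathbf{M}_n = \mathbf{M}([n])$ is a $\mathbf{P}_n$-module and $\mathbf{M}(\varepsilon)(aq) = \varepsilon_*(a)\,\mathbf{M}(\varepsilon)(q)$ for all $\varepsilon\colon[m]\to[n]$, $a\in\mathbf{P}_m$, $q\in\mathbf{M}_m$. It is graded if every $\mathbf{M}_n$ is a $\mathbb{Z}$-graded $\mathbf{P}_n$-module and every $\mathbf{M}(\varepsilon)$ is homogeneous of degree $0$. A subset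 of $\coprod_n\mathbf{M}_n$ generates $\mathbf{M}$ if it is not contained in any proper submodule (subfunctor compatible with the module structures); $\mathbf{M}$ is finitely generated if it has a finite generating set, and generated in non-negative degrees if it has a generating set consisting of homogeneous elements of non-negative degrees. $\mathbf{M}$ is said to be Artinian if there is an integer $n_0$ such that the $\mathbf{P}_n$-module $\mathbf{M}_n$ is Artinian (in the usual sense) for every $n\ge n_0$. The equivariant Hilbert series is $H_{\mathbf{M}}(s,t) = \sum_{n\ge0,\,j\in\mathbb{Z}} \dim_K[\mathbf{M}_n]_j\, s^n t^j$, where $[\mathbf{M}_n]_j$ is the degree $j$ component of $\mathbf{M}_n$; identities are understood as identities of power series in $s$ whose coefficients (the Hilbert series of the $\mathbf{M}_n$) are rational functions in $t$. Empty products equal $1$. *)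

(* Defs.v *)
From HB Require Import structures.
From mathcomp Require Import all_boot all_order all_algebra fraction.
From mathcomp Require Import mpoly.

Set Implicit Arguments.
Unset Strict Implicit.
Unset Printing Implicit Defensive.

Import Order.TTheory GRing.Theory Num.Theory.
Local Open Scope ring_scope.

(* The categories OI and FI. The object [n] is 'I_n = {0, ..., n-1}. *)

Variant OI_or_FI := OI | FI.

Definition is_hom (X : OI_or_FI) (m n : nat) (f : {ffun 'I_m -> 'I_n}) : bool :=
  match X with
  | OI => [forall i : 'I_m, forall j : 'I_m, (i < j)%N ==> (f i < f j)%N]
  | FI => injectiveb f
  end.

Definition hom (X : OI_or_FI) (m n : nat) : Type :=
  {f : {ffun 'I_m -> 'I_n} | is_hom X f}.

Lemma is_hom_id X n : @is_hom X n n [ffun i => i].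
Proof.
case: X => /=.
  by apply/forallP => i; apply/forallP => j; rewrite !ffunE; apply/implyP.
by apply/injectiveP => i j; rewrite !ffunE.
Qed.

Lemma is_hom_comp X m n p (g : hom X n p) (f : hom X m n) :
  is_hom X [ffun i => sval g (sval f i)].
Proof.
case: X g f => -[g hg] [f hf] /=.
  apply/forallP => i; apply/forallP => j; apply/implyP => ltij; rewrite !ffunE.
  have ltf : (f i < f j)%N.
    by move/forallP/(_ i)/forallP/(_ j)/implyP: hf; apply.
  by move/forallP/(_ (f i))/forallP/(_ (f j))/implyP: hg; apply.
move/injectiveP: hg => hg; move/injectiveP: hf => hf.
by apply/injectiveP => i j; rewrite !ffunE => /hg /hf.
Qed.

Definition hom_id X n : hom X n n := exist (fun f => is_hom X f) _ (is_hom_id X n).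

Definition hom_comp X m n p (g : hom X n p) (f : hom X m n) : hom X m p :=
  exist (fun h => is_hom X h) _ (is_hom_comp g f).

(* P_n = K[x_{i,j} : i < c, j < n]. The variable x_{i,j} is the mpoly variable
   whose index is the rank of (i, j) in the enumeration of 'I_c * 'I_n. *)

Notation coef_alg K c n := {mpoly K[#|{: 'I_c * 'I_n}|]}.

Definition xvar (K : fieldType) (c n : nat) (i : 'I_c) (j : 'I_n) :
  coef_alg K c n := 'X_(enum_rank (i, j)).

Definition push (K : fieldType) (c : nat) (X : OI_or_FI) (m n : nat)
    (eps : hom X m n) (a : coef_alg K c m) : coef_alg K c n :=
  a \mPo [tuple xvar K (enum_val k).1 (sval eps (enum_val k).2)
           | k < #|{: 'I_c * 'I_m}|].

(* The K-vector space structure of M_n is the one induced by its P_n-module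
   structure along K -> P_n, so K-linearity of fmod_map eps is a special case
   of fmod_mapZ. *)

Record fmodule (K : fieldType) (c : nat) (X : OI_or_FI) := FModule {
  fmod_obj :> forall n : nat, lmodType (coef_alg K c n);
  fmod_map : forall m n : nat, hom X m n -> fmod_obj m -> fmod_obj n;
  fmod_mapD : forall m n (eps : hom X m n) (q r : fmod_obj m),
    fmod_map eps (q + r) = fmod_map eps q + fmod_map eps r;
  fmod_mapZ : forall m n (eps : hom X m n) (a : coef_alg K c m) (q : fmod_obj m),
    fmod_map eps (a *: q) = push eps a *: fmod_map eps q;
  fmod_map_id : forall n (q : fmod_obj n), fmod_map (hom_id X n) q = q;
  fmod_map_comp : forall m n p (g : hom X n p) (f : hom X m n) (q : fmod_obj m),
    fmod_map (hom_comp g f) q = fmod_map g (fmod_map f q)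
}.

Record grading (K : fieldType) (c : nat) (X : OI_or_FI) (M : fmodule K c X) :=
  Grading {
  gcomp : forall n : nat, int -> M n -> Prop;
  gcomp0 : forall n j, gcomp j (0 : M n);
  gcompD : forall n j (q r : M n), gcomp j q -> gcomp j r -> gcomp j (q + r);
  gcompZ : forall n j (d : nat) (a : coef_alg K c n) (q : M n),
    a \is d.-homog -> gcomp j q -> gcomp (d%:Z + j) (a *: q);
  gcomp_sum : forall n (q : M n), exists (s : seq int) (u : int -> M n),
    [/\ uniq s, forall j, gcomp j (u j) & q = \sum_(j <- s) u j];
  gcomp_direct : forall n (s : seq int) (u : int -> M n),
    uniq s -> (forall j, gcomp j (u j)) -> \sum_(j <- s) u j = 0 ->
    forall j, j \in s -> u j = 0;
  gcomp_map : forall m n (eps : hom X m n) j (q : M m),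
    gcomp j q -> gcomp j (fmod_map eps q)
}.

Definition is_submodule (R : nzRingType) (V : lmodType R) (N : V -> Prop) : Prop :=
  [/\ N 0, forall q r, N q -> N r -> N (q + r) & forall a q, N q -> N (a *: q)].

Definition artinian_module (R : nzRingType) (V : lmodType R) : Prop :=
  forall N : nat -> V -> Prop,
    (forall i, is_submodule (N i)) ->
    (forall i q, N i.+1 q -> N i q) ->
    exists i0 : nat, forall i, (i0 <= i)%N -> forall q, N i q <-> N i0 q.

Section FModuleNotions.
Variables (K : fieldType) (c : nat) (X : OI_or_FI) (M : fmodule K c X).

Definition is_subfmodule (N : forall n, M n -> Prop) : Prop :=
  (forall n, is_submodule (@N n)) /\
  (forall m n (eps : hom X m n) (q : M m), N m q -> N n (fmod_map eps q)).

Definition generates (S : forall n, M n -> Prop) : Prop :=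
  forall N : forall n, M n -> Prop,
    is_subfmodule N -> (forall n q, S n q -> N n q) -> forall n q, N n q.

Definition finitely_generated : Prop :=
  exists s : seq {n : nat & M n}, generates (fun n q => Tagged (fun n => M n) q \in s).

Definition generated_nonneg (G : grading M) : Prop :=
  exists S : forall n, M n -> Prop,
    generates S /\
    (forall n (q : M n), S n q -> exists2 j : int, 0 <= j & gcomp G j q).

Definition artinian : Prop :=
  exists n0 : nat, forall n, (n0 <= n)%N -> artinian_module (M n).

(* W is a K-subspace of M n of dimension d: it has a basis of d vectors. *)
Definition has_dim (n : nat) (W : M n -> Prop) (d : nat) : Prop :=
  exists v : 'I_d -> M n,
    [/\ forall i, W (v i),
        forall q, W q -> exists a : 'I_d -> K, q = \sum_i (a i)%:MP *: v i
      & forall a : 'I_d -> K, \sum_i (a i)%:MP *: v i = 0 -> forall i, a i = 0].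

End FModuleNotions.

Notation "x %:F" := (@FracField.tofrac _ x) : ring_scope.

(* The formal Laurent series \sum_k a_k t^k is the expansion at t = 0 of the
   rational function r = p / q, that is, q * \sum_k a_k t^k = p as Laurent
   series. The first condition makes \sum_k a_k t^k a Laurent series (finitely
   many negative exponents), so that this determines it. *)
Definition laurent_expansion (F : fieldType) (a : int -> F)
    (r : {fraction {poly F}}) : Prop :=
  (exists N : int, forall k, k < N -> a k = 0) /\
  (exists p q : {poly F},
    [/\ q != 0, r = p%:F / q%:F
      & forall k : int, \sum_(i < size q) q`_i * a (k - i%:Z)
                        = if k is Posz m then p`_m else 0]).

Notation Qt := {fraction {poly rat}}.
Notation Qts := {fraction {poly Qt}}.

Definition Zt_Qt (p : {poly int}) : Qt := (map_poly (intr : int -> rat) p)%:F.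

(* In Z[s,t] = {poly {poly int}} and in Q(t)[s] = {poly Qt}, the outer variable
   is s. *)
Definition Zst_Qts (p : {poly {poly int}}) : {poly Qt} := map_poly Zt_Qt p.

(* H_M(s,t) = R: the coefficient of s^n in H_M(s,t) is the rational function
   H_{M_n}(t) = \sum_j dim_K [M_n]_j t^j, and the power series in s over Q(t)
   with these coefficients is the expansion of R in Q(t)(s). *)
Definition equivariant_hilbert_series (K : fieldType) (c : nat) (X : OI_or_FI)
    (M : fmodule K c X) (G : grading M) (R : Qts) : Prop :=
  exists (dim : nat -> int -> nat) (H : nat -> Qt),
    [/\ forall n j, has_dim (@gcomp _ _ _ _ G n j) (dim n j),
        forall n, laurent_expansion (fun j => (dim n j)%:R : rat) (H n)
      & laurent_expansion (fun k : int => if k is Posz n then H n else 0) R].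

(* Main.v *)
(* Finitely many homogeneous elements g_k of widths d_k generate M along increasing
   maps (an injection is an increasing map after a permutation), so M_n is spanned
   over K by the elements x^u eps_*(g_k). Such an element is encoded by k and a word
   of length n whose p-th letter records the exponents of the x_{i,p} and whether p
   lies in the image of eps. A word is standard if its element is not a combination
   of those of smaller words for a lexicographic order; standard words give bases of
   the graded pieces, and they are stable under division and under deletion of
   letters outside the image of eps.

   If a language L is stable under deletion of unmarked letters, its left quotient
   a^-1 L by such a letter is contained in L, and Higman's lemma makes strict
   inclusion of such languages well founded. Grouping the letters with a^-1 L = L
   into the factor 1 - s f, f being the sum of their weights, and inducting on the
   other quotients shows that the generating function of L is rational. Applied to
   sorted words in the x_{i,p} this gives denominators (1 - t)^r for each M_n; if M
   is Artinian, the exponents of standard words of large width are bounded, and the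
   same result applied to words over the resulting finite alphabet gives the
   denominator prod_j (1 - s f_j), where the unmarked blank letter contributes
   f_j(0) = 1. Pseudo-division in s then yields the stated form; a numerator divisible
   by 1 - t would force dim M_n = 0 for large n, hence h = 0.

   Conversely, the stated form makes (f_1 ... f_b)^e H_{M_n} a polynomial for large n.
   As H_{M_n} has a denominator (1 - t)^r, which is coprime to the f_j, it is a
   polynomial itself, so M_n is finite-dimensional, hence Artinian. *)

From Stdlib Require Import Classical ClassicalEpsilon FunctionalExtensionality.
From HB Require Import structures.
From mathcomp Require Import all_boot all_order all_algebra fraction.
From mathcomp Require Import mpoly ring.
Require Import Defs.

Set Implicit Arguments.
Unset Strict Implicit.
Unset Printing Implicit Defensive.

Import Order.TTheory GRing.Theory Num.Theory.

(** * Higman's lemma for words over a finite alphabet *)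

(** Infinite pigeonhole, by induction on [s]: if the head of [s] occurs at no index of [P] beyond
    some [N], it is discarded and [P] is cut down to the indices from [N] on. *)
Lemma frequent_letter (A : eqType) (x : nat -> A) (s : seq A) (P : pred nat) :
  (forall N, exists2 n, (N <= n)%N & P n) -> (forall n, P n -> x n \in s) ->
  exists a, forall N, exists n, [/\ (N <= n)%N, P n & x n = a].
Proof.
elim: s P => [|a s IHs] P infP xs.
  by have [n _ /xs] := infP 0%N.
case: (classic (forall N, exists n, [/\ (N <= n)%N, P n & x n = a])) => [|ninf].
  by exists a.
have [N hN] := not_all_ex_not _ _ ninf.
have [||b hb] := IHs [pred n | P n & (N <= n)%N].
- move=> N'; have [n leN Pn] := infP (maxn N N').
  move: leN; rewrite geq_max => /andP[leN leN'].
  by exists n => //=; rewrite Pn.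
- move=> n /= /andP[Pn leN]; move: (xs n Pn); rewrite inE => /orP[/eqP xa|//].
  by case: hN; exists n.
by exists b => N'; have [n [leN /= /andP[Pn _] xb]] := hb N'; exists n.
Qed.

Definition bad_seq (A : eqType) (s : seq A) (f : nat -> seq A) :=
  (forall i, {subset f i <= s}) /\
  (forall i j, (i < j)%N -> ~~ subseq (f i) (f j)).

(* Nash-Williams' minimal bad sequence argument. *)
Lemma higman (A : eqType) (s : seq A) (f : nat -> seq A) :
  (forall i, {subset f i <= s}) -> exists i j, (i < j)%N /\ subseq (f i) (f j).
Proof.
move=> fs; apply: NNPP => nobad.
have {nobad fs} badf : bad_seq s f.
  split=> // i j ltij; apply/negP => sij; apply: nobad; by exists i, j.
(* [ext p] says that [p] is a prefix of a bad sequence. Extending such a prefix each time by a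
   shortest possible word produces the minimal bad sequence [g]. *)
pose ext p := exists f, bad_seq s f /\ p = mkseq f (size p).
have ext0 : ext [::] by exists f.
have step p : ext p -> exists w, ext (rcons p w) /\
    forall w', ext (rcons p w') -> (size w <= size w')%N.
  move=> [g [badg pg]]; apply: NNPP => nomin.
  have H m : forall w, ext (rcons p w) -> (size w < m)%N -> False.
    elim: m => // m IHm w extw ltw; apply: nomin; exists w; split=> // w' extw'.
    rewrite leqNgt; apply/negP => ltw'; apply: (IHm w' extw').
    by apply: leq_trans ltw' _; rewrite -ltnS.
  apply: (H (size (g (size p))).+1 (g (size p))) => //.
  by exists g; split=> //; rewrite size_rcons mkseqS -pg.
pose nxt p := epsilon (inhabits [::]) (fun w => ext (rcons p w) /\
    forall w', ext (rcons p w') -> (size w <= size w')%N).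
have nxtP p : ext p -> ext (rcons p (nxt p)) /\
    forall w', ext (rcons p w') -> (size (nxt p) <= size w')%N.
  by move=> extp; apply: (epsilon_spec (inhabits _) _ (step p extp)).
pose pre n := iter n (fun p => rcons p (nxt p)) [::].
have extpre n : ext (pre n) by elim: n => //= n /nxtP[].
pose g n := nxt (pre n).
have preE n : pre n = mkseq g n by elim: n => //= n IHn; rewrite mkseqS -IHn.
have badg : bad_seq s g.
  have gn n : exists2 g', bad_seq s g' & forall i, (i <= n)%N -> g i = g' i.
    have [g' [badg' eg']] := extpre n.+1; exists g' => // i lei.
    move: eg'; rewrite preE size_mkseq => /(congr1 (nth [::] ^~ i)).
    by rewrite !nth_mkseq.
  split=> [i|i j ltij]; first by have [g' [sg' _] ->] := gn i.
  by have [g' [_ bg'] eg] := gn j; rewrite !eg // 1?ltnW // bg'.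
case: badg => gs gbad.
have [a0 hd] : exists a0 : A, forall n, g n = head a0 (g n) :: behead (g n).
  have nnil n : g n != [::].
    by apply: contraNneq (gbad n n.+1 (ltnSn n)) => ->; rewrite sub0seq.
  case g0: (g 0%N) (nnil 0%N) => [//|a0 r] _; exists a0 => n.
  by case: (g n) (nnil n).
have [|n _|a ha] := @frequent_letter A (fun n => head a0 (g n)) s predT.
- by move=> N; exists N.
- by apply: (gs n); rewrite hd mem_head.
have {}ha N : exists n, (N <= n)%N /\ g n = a :: behead (g n).
  by have [n [? _ <-]] := ha N; exists n; split; rewrite -?hd.
pose h N := epsilon (inhabits 0%N) (fun n => (N <= n)%N /\ g n = a :: behead (g n)).
have hP N : (N <= h N)%N /\ g (h N) = a :: behead (g (h N)).
  exact: (epsilon_spec (inhabits 0%N) _ (ha N)).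
pose phi k := iter k (fun n => h n.+1) (h 0%N).
have phiS k : (phi k < phi k.+1)%N by have [] := hP (phi k).+1.
have phi_lt k l : (k < l)%N -> (phi k < phi l)%N.
  elim: l => // l IHl; rewrite ltnS leq_eqVlt => /orP[/eqP->//|/IHl/ltn_trans].
  exact.
have phia k : g (phi k) = a :: behead (g (phi k)).
  by case: k => [|k]; apply: (proj2 (hP _)).
(* The words of [g] before [phi 0], followed by the tails of the words [g (phi k)], which all begin
   with [a]. This sequence is again bad, but its word at [phi 0] is shorter than [g (phi 0)],
   against minimality. *)
pose f' i := if (i < phi 0)%N then g i else behead (g (phi (i - phi 0))).
have subb (w : seq A) : subseq (behead w) w.
  by case: w => //= x w; apply: subseq_cons.
have badf' : bad_seq s f'.
  split=> [i|i j ltij]; rewrite /f'.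
    by case: ifP => _ x; [apply: gs|move/(mem_subseq (subb _)); apply: gs].
  case: ltnP => [lti|lei]; case: ltnP => [ltj|lej].
  - exact: gbad.
  - have ltij' : (i < phi (j - phi 0))%N.
      apply: leq_trans lti _; case: (j - phi 0)%N => // l.
      exact/ltnW/phi_lt.
    apply: contra (gbad _ _ ltij') => /subseq_trans; apply; exact: subb.
  - by move: (leq_ltn_trans lei (ltn_trans ltij ltj)); rewrite ltnn.
  apply: contra (gbad _ _ (phi_lt (i - phi 0) (j - phi 0) _))%N => [|].
    by rewrite phia (phia (j - phi 0)%N) /= eqxx.
  by rewrite ltn_sub2r // (leq_ltn_trans lei).
have : ext (rcons (pre (phi 0)) (f' (phi 0))).
  exists f'; split=> //; rewrite size_rcons mkseqS preE size_mkseq; congr rcons.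
  apply: (@eq_from_nth _ [::]); rewrite ?size_mkseq // => i lti.
  by rewrite !nth_mkseq // /f' lti.
move/(proj2 (nxtP _ (extpre _))); rewrite -/(g _) /f' ltnn subnn phia /=.
by rewrite ltnn.
Qed.

Local Open Scope ring_scope.

(** * Power series with rational generating function *)

(** Power series are represented by their coefficient functions; this is the Cauchy product of a
    polynomial with a series. *)
Definition psmul (R : nzRingType) (q : {poly R}) (a : nat -> R) (k : nat) : R :=
  \sum_(i < k.+1) q`_i * a (k - i)%N.

Section PowerSeries.
Variable R : comNzRingType.
Implicit Types (p q : {poly R}) (a b : nat -> R).

Lemma psmulE q a k N : (k < N)%N -> psmul q a k = (q * \poly_(i < N) a i)`_k.
Proof.
move=> ltkN; rewrite coefM; apply: eq_bigr => i _.
by rewrite coef_poly (leq_ltn_trans (leq_subr _ _) ltkN).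
Qed.

Lemma psmul_coef q p k : psmul q (fun i => p`_i) k = (q * p)`_k.
Proof. by rewrite coefM. Qed.

Lemma eq_psmul q a b : a =1 b -> psmul q a =1 psmul q b.
Proof. by move=> eqab k; apply: eq_bigr => i _; rewrite eqab. Qed.

Lemma psmulA p q a : psmul (p * q) a =1 psmul p (psmul q a).
Proof.
move=> k; rewrite (@psmulE _ _ _ k.+1) // -mulrA coefM; apply: eq_bigr => i _.
by rewrite -psmulE // ltnS leq_subr.
Qed.

Lemma psmulDr q a b k : psmul q (fun i => a i + b i) k = psmul q a k + psmul q b k.
Proof. by rewrite -big_split; apply: eq_bigr => i _; rewrite mulrDr. Qed.

Lemma psmulDl p q a k : psmul (p + q) a k = psmul p a k + psmul q a k.
Proof. by rewrite -big_split; apply: eq_bigr => i _; rewrite coefD mulrDl. Qed.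

Lemma psmulNl q a k : psmul (- q) a k = - psmul q a k.
Proof. by rewrite -sumrN; apply: eq_bigr => i _; rewrite coefN mulNr. Qed.

Lemma psmulC c a k : psmul c%:P a k = c * a k.
Proof.
rewrite /psmul big_ord_recl coefC eqxx subn0 big1 ?addr0 // => i _.
by rewrite coefC mul0r.
Qed.

Lemma psmulX a k : psmul 'X a k = if k is k'.+1 then a k' else 0.
Proof.
case: k => [|k]; first by rewrite /psmul big_ord1 coefX mul0r.
rewrite /psmul big_ord_recl coefX mul0r add0r big_ord_recl coefX mul1r subn1.
by rewrite big1 ?addr0 // => i _; rewrite coefX mul0r.
Qed.

Lemma psmul_Xn n a k :
  psmul 'X^n a k = if (n <= k)%N then a (k - n)%N else 0.
Proof.
elim: n k => [|n IHn] k; first by rewrite -[X in psmul X]/1%:P psmulC mul1r subn0.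
by rewrite exprS psmulA psmulX; case: k => // k; rewrite IHn.
Qed.

Definition geom_prod (fs : seq R) : {poly R} := \prod_(f <- fs) (1 - f *: 'X).

Lemma geom_prod_coef0 fs : (geom_prod fs)`_0 = 1.
Proof.
rewrite /geom_prod; elim: fs => [|f fs IHfs]; first by rewrite big_nil coef1.
by rewrite big_cons coef0M IHfs coefB coef1 coefZ coefX mulr0 subr0 mulr1.
Qed.

Variable Good : R -> Prop.

(** The denominator is kept as a product of factors 1 - f s, with s the series variable, so that
    [Good] can record where each f comes from. *)
Definition rational_series a :=
  exists fs p, (forall f, f \in fs -> Good f) /\
    forall k, psmul (geom_prod fs) a k = p`_k.

Lemma eq_rational_series a b : a =1 b -> rational_series a -> rational_series b.
Proof.
move=> eqab [fs [p [gfs Ep]]]; exists fs, p; split=> // k.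
by rewrite -Ep; apply/esym/eq_psmul.
Qed.

Lemma rational_coef p : rational_series (fun k => p`_k).
Proof.
by exists [::], p; split=> // k; rewrite /geom_prod big_nil psmul_coef mul1r.
Qed.

Lemma rational_psmul q a : rational_series a -> rational_series (psmul q a).
Proof.
case=> fs [p [gfs Ep]]; exists fs, (q * p); split=> // k.
by rewrite -psmulA mulrC psmulA (eq_psmul _ Ep) psmul_coef.
Qed.

Lemma rationalD a b :
  rational_series a -> rational_series b -> rational_series (fun k => a k + b k).
Proof.
case=> fs [p [gfs Ep]] [gs [q [ggs Eq]]].
exists (fs ++ gs), (geom_prod gs * p + geom_prod fs * q); split=> [f|k].
  by rewrite mem_cat => /orP[/gfs|/ggs].
have E : geom_prod (fs ++ gs) = geom_prod fs * geom_prod gs by rewrite /geom_prod big_cat.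
rewrite psmulDr coefD {1}E mulrC psmulA (eq_psmul _ Ep) psmul_coef E psmulA.
by rewrite (eq_psmul _ Eq) psmul_coef.
Qed.

Lemma rational_sum (I : Type) (r : seq I) (P : pred I) (a : I -> nat -> R) :
  (forall i, P i -> rational_series (a i)) ->
  rational_series (fun k => \sum_(i <- r | P i) a i k).
Proof.
move=> ra; elim: r => [|i r IHr].
  by apply: eq_rational_series (rational_coef 0) => k; rewrite big_nil coef0.
case Pi: (P i); last by apply: eq_rational_series IHr => k; rewrite big_cons Pi.
apply: eq_rational_series (rationalD (ra i Pi) IHr) => k.
by rewrite big_cons Pi.
Qed.

Lemma rational_geom f a :
  Good f -> rational_series (psmul (1 - f *: 'X) a) -> rational_series a.
Proof.
move=> gf [fs [p [gfs Ep]]]; exists (f :: fs), p; split=> [g|k].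
  by rewrite inE => /orP[/eqP->|/gfs].
by rewrite /geom_prod big_cons mulrC psmulA Ep.
Qed.

End PowerSeries.

(** * Generating functions of languages closed under deletion *)

Definition pbool (P : Prop) : bool :=
  if excluded_middle_informative P then true else false.

Lemma pboolP (P : Prop) : reflect P (pbool P).
Proof. by rewrite /pbool; case: excluded_middle_informative => ?; constructor. Qed.

Section Languages.
Variables (A : eqType) (alph : seq A) (marked : pred A).

Fixpoint words (n : nat) : seq (seq A) :=
  if n is n'.+1 then [seq a :: w | a <- alph, w <- words n'] else [:: [::]].

Lemma mem_words n w : (w \in words n) = (size w == n) && all (mem alph) w.
Proof.
elim: n w => [|n IHn] [|a w] //.
  by apply/negP => /allpairsP[[? ?] []].
apply/allpairsP/andP => [[[b v] /= [b_alph]]|].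
  by rewrite IHn => /andP[/eqP sv va] [-> ->]; rewrite sv b_alph.
case=> /= /eqP[sw] /andP[a_alph wa]; exists (a, w); split=> //=.
by rewrite IHn sw eqxx.
Qed.

Lemma words_uniq n : uniq alph -> uniq (words n).
Proof.
move=> ualph; elim: n => // n IHn; apply: allpairs_uniq => //.
by move=> [a v] [b w] _ _ /= [-> ->].
Qed.

Definition quot (a : A) (L : pred (seq A)) : pred (seq A) := fun w => L (a :: w).

(** In the automaton whose states are the left quotients of a language, these are the unmarked
    letters that label loops at the state [L]. *)
Definition loops (L : pred (seq A)) : seq A :=
  [seq a <- alph | ~~ marked a & pbool (quot a L =1 L)].

Variables (R : comNzRingType) (wt : A -> R).

Definition lang_series (L : pred (seq A)) (n : nat) : R :=
  \sum_(w <- words n | L w) \prod_(a <- w) wt a.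

Lemma lang_series0 L n : (forall w, L w = false) -> lang_series L n = 0.
Proof. by move=> L0; rewrite /lang_series big1 // => w; rewrite L0. Qed.

Lemma lang_seriesS L n :
  lang_series L n.+1 = \sum_(a <- alph) wt a * lang_series (quot a L) n.
Proof.
rewrite /lang_series /= big_mkcond big_allpairs_dep /=.
apply: eq_bigr => a _; rewrite big_distrr [RHS]big_mkcond; apply: eq_bigr => w _.
by rewrite big_cons.
Qed.

(** [cls d] is a class of languages whose words all have exactly [d] marked letters. Keeping it
    abstract allows two uses: words of letters with exponents and marks, and sorted sequences of
    variables, where no letter is marked. *)
Variable cls : nat -> pred (seq A) -> Prop.
Hypothesis cls_alph : forall d L w, cls d L -> L w -> {subset w <= alph}.
Hypothesis cls_count : forall d L w, cls d L -> L w -> count marked w = d.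
Hypothesis cls_del : forall d L u a v,
  cls d L -> ~~ marked a -> L (u ++ a :: v) -> L (u ++ v).
Hypothesis cls_quot : forall d L a, cls d L -> a \in alph -> ~~ marked a -> cls d (quot a L).
Hypothesis cls_quot_marked : forall d L a,
  cls d.+1 L -> a \in alph -> marked a -> cls d (quot a L).

(** Both words have [d] marked letters, so every letter of [w] outside [v] is unmarked and may be
    deleted. The prefix [u] in the induction holds the letters already matched. *)
Lemma cls_subseq d L v w : cls d L ->
  subseq v w -> count marked v = d -> L w -> L v.
Proof.
move=> cL.
suff H u : subseq v w -> (count marked u + count marked v)%N = d ->
    L (u ++ w) -> L (u ++ v) by apply: (H [::]).
elim: w v u => [|b w IHw] v u; first by rewrite subseq0 => /eqP->.
move=> svw cv Lw; have cw := cls_count cL Lw.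
case: v svw cv => [|a v] svw cv.
  have nb : ~~ marked b.
    move: cw; rewrite -{}cv count_cat /= => /eqP; rewrite eqn_add2l.
    by case: (marked b).
  by apply: IHw => //; [apply: sub0seq | apply: cls_del cL nb Lw].
move: svw => /=; case: eqP => [eab svw|_ svw]; first subst a.
  rewrite -!cat_rcons; apply: IHw; rewrite ?cat_rcons //.
  by rewrite -cats1 count_cat /= addn0 -addnA -cv.
have nb : ~~ marked b.
  apply/negP => mb; have := leq_count_subseq marked svw.
  move: cw; rewrite -cv count_cat [count marked (b :: w)]/= mb => /addnI <-.
  by rewrite ltnn.
by apply: IHw => //; apply: cls_del cL nb Lw.
Qed.

(** Well-founded induction on strict inclusion. In an infinite strictly decreasing chain choose
    [f n] in term [n] but not in term [n.+1]. Higman's lemma makes some [f i] a subword of [f j]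
    with i < j; as [f j] lies in term [i.+1], so does [f i], a contradiction. *)
Lemma cls_ind d (P : pred (seq A) -> Prop) :
  (forall L, cls d L ->
     (forall L', cls d L' -> (forall w, L' w -> L w) ->
        (exists w, L w /\ ~~ L' w) -> P L') -> P L) ->
  forall L, cls d L -> P L.
Proof.
move=> IH L0 cL0; apply: NNPP => nPL0.
pose lt (L' L : pred (seq A)) := [/\ cls d L', ~ P L', forall w, L' w -> L w & exists w, L w /\ ~~ L' w].
have down L : cls d L -> ~ P L -> exists L', lt L' L.
  move=> cL nPL; apply: NNPP => nlt; apply: (nPL); apply: IH => // L' cL' sub strict.
  by apply: NNPP => nPL'; apply: nlt; exists L'.
pose nxt (L : pred (seq A)) := epsilon (inhabits L0) (fun L' => lt L' L).
have nxtP L : cls d L -> ~ P L -> lt (nxt L) L.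
  by move=> cL nPL; apply: (epsilon_spec (inhabits L0) _ (down L cL nPL)).
pose chain n := iter n nxt L0.
have chainP n : cls d (chain n) /\ ~ P (chain n).
  by elim: n => //= n [cL nPL]; have [] := nxtP _ cL nPL.
have chainS n : lt (chain n.+1) (chain n) by have [/nxtP] := chainP n.
have chain_sub m n : (m <= n)%N -> forall w, chain n w -> chain m w.
  elim: n => [|n IHn]; first by rewrite leqn0 => /eqP->.
  rewrite leq_eqVlt => /orP[/eqP->//|]; rewrite ltnS => /IHn sub w.
  by have [_ _ sub' _] := chainS n; move/sub'; apply: sub.
pose f n := epsilon (inhabits [::]) (fun w => chain n w /\ ~~ chain n.+1 w).
have fP n : chain n (f n) /\ ~~ chain n.+1 (f n).
  by have [_ _ _ ex] := chainS n; apply: (epsilon_spec (inhabits [::]) _ ex).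
have [|i [j [ltij sij]]] := @higman A alph f.
  by move=> i; have [ci _] := chainP i; apply: cls_alph ci (proj1 (fP i)).
case/negP: (proj2 (fP i)); have [ci _] := chainP i; have [ci1 _] := chainP i.+1.
apply: (cls_subseq ci1 sij); first exact: cls_count ci (proj1 (fP i)).
exact: chain_sub ltij _ (proj1 (fP j)).
Qed.

Definition loop_weight (f : R) := exists d L,
  [/\ cls d L, exists w, L w, loops L != [::] & f = \sum_(a <- loops L) wt a].

Lemma lang_rational_step d :
  (forall L a, cls d L -> a \in alph -> marked a ->
     rational_series loop_weight (lang_series (quot a L))) ->
  forall L, cls d L -> rational_series loop_weight (lang_series L).
Proof.
move=> rmarked L cL; move: L cL; apply: (@cls_ind d) => L cL IHL.
case: (classic (exists w, L w)) => [neL|emL]; last first.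
  apply: eq_rational_series (rational_coef _ 0) => n.
  rewrite coef0 lang_series0 // => w; apply: negbTE; apply/negP => Lw.
  by apply: emL; exists w.
pose loop a := ~~ marked a && pbool (quot a L =1 L).
(* Deletion puts the quotient by an unmarked letter inside [L], strictly if the letter is not a
   loop, so [IHL] applies; marked letters are covered by [rmarked]. *)
have rquot a : a \in alph -> ~~ loop a ->
    rational_series loop_weight (lang_series (quot a L)).
  move=> a_alph; case ma: (marked a); first by move=> _; apply: rmarked cL _ ma.
  rewrite /loop ma /= => /pboolP ne.
  have cq : cls d (quot a L) by apply: cls_quot; rewrite ?ma.
  have sub w : quot a L w -> L w by apply: (@cls_del d L [::] a w cL); rewrite ma.
  apply: (IHL _ cq sub).
  apply: NNPP => nex; apply: ne => w; apply/idP/idP => [/sub//|Lw].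
  by apply/negPn/negP => nqw; apply: nex; exists w.
pose f := \sum_(a <- loops L) wt a.
(* Words are sorted by their first letter. With L also denoting the series, (1 - s f) L is the
   contribution of the empty word plus s times the sum of wt(a) a^-1 L over the letters a that are
   not loops. *)
have rec n : psmul (1 - f *: 'X) (lang_series L) n = (L [::])%:R%:P`_n +
    psmul 'X (fun k => \sum_(a <- alph | (a \in alph) && ~~ loop a)
                       wt a * lang_series (quot a L) k) n.
  rewrite psmulDl psmulNl -mul_polyC psmulA !psmulC mul1r !psmulX coefC.
  case: n => [|n].
    rewrite mulr0 subr0 addr0 /lang_series /= big_mkcond big_seq1 big_nil.
    by case: (L _).
  rewrite lang_seriesS add0r (bigID loop) /=.
  have -> : \sum_(a <- alph | loop a) wt a * lang_series (quot a L) n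
      = f * lang_series L n.
    rewrite /f /loops big_filter mulr_suml; apply: eq_bigr => a /andP[_ /pboolP qa].
    by congr (_ * _); rewrite /lang_series; apply: eq_bigl.
  by rewrite addrAC subrr add0r big_seq_cond.
have rR : rational_series loop_weight (psmul (1 - f *: 'X) (lang_series L)).
  apply: eq_rational_series (fun n => esym (rec n)) _.
  apply: rationalD; first exact: rational_coef.
  apply: rational_psmul; apply: rational_sum => a /andP[a_alph nla].
  apply: (@eq_rational_series _ _ (psmul (wt a)%:P (lang_series (quot a L)))).
    by move=> n; rewrite psmulC.
  exact/rational_psmul/rquot.
case: (altP (loops L =P [::])) => [l0|ln0]; last first.
  by apply: rational_geom rR; exists d, L.
apply: eq_rational_series rR => n.
by rewrite /f l0 big_nil scale0r subr0 -[1]/1%:P psmulC mul1r.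
Qed.

Lemma lang_rational d L : cls d L -> rational_series loop_weight (lang_series L).
Proof.
elim: d L => [|d IHd]; apply: lang_rational_step => L a cL a_alph ma.
  apply: eq_rational_series (rational_coef _ 0) => n.
  rewrite coef0 lang_series0 // => w; apply: negbTE; apply/negP => Lw.
  by have := cls_count cL Lw; rewrite /= ma.
exact/IHd/cls_quot_marked.
Qed.

End Languages.

(** * Linear algebra with predicates as subspaces *)

(** Subspaces are predicates, so the span is an inductive predicate. The ring is arbitrary because
    spans over P_n and over K both occur. *)
Inductive lspan (R : nzRingType) (V : lmodType R) (S : V -> Prop) : V -> Prop :=
| lspan0 : lspan S 0
| lspanZD a v u : S v -> lspan S u -> lspan S (a *: v + u).

Section Span.
Variables (R : nzRingType) (V : lmodType R).
Implicit Types (S N : V -> Prop) (u v : V).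

Lemma lspan_gen S v : S v -> lspan S v.
Proof. by move=> Sv; rewrite -[v]scale1r -[_ *: _]addr0; apply: lspanZD Sv (lspan0 _). Qed.

Lemma lspanD S u v : lspan S u -> lspan S v -> lspan S (u + v).
Proof.
move=> su sv; elim: su => [|a w w' Sw _ IHw]; first by rewrite add0r.
by rewrite -addrA; apply: lspanZD.
Qed.

Lemma lspanZ S a v : lspan S v -> lspan S (a *: v).
Proof.
elim=> [|b w w' Sw _ IHw]; first by rewrite scaler0; apply: lspan0.
by rewrite scalerDr scalerA; apply: lspanZD.
Qed.

Lemma lspan_submodule S : is_submodule (lspan S).
Proof. by split=> [|u v|a v]; [apply: lspan0 | apply: lspanD | apply: lspanZ]. Qed.

Lemma lspan_min S N v : is_submodule N -> (forall u, S u -> N u) -> lspan S v -> N v.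
Proof.
move=> [N0 ND NZ] SN; elim=> // a w w' Sw _ Nw'.
by apply: ND => //; apply: NZ; apply: SN.
Qed.

Lemma lspanS S S' v : (forall u, S u -> S' u) -> lspan S v -> lspan S' v.
Proof.
by move=> sub; apply: lspan_min (lspan_submodule _) _ => u /sub/lspan_gen.
Qed.

Lemma lspan_sum S (I : Type) (r : seq I) (P : pred I) (F : I -> V) :
  (forall i, P i -> lspan S (F i)) -> lspan S (\sum_(i <- r | P i) F i).
Proof.
by move=> SF; apply: (big_ind (lspan S)) SF; [apply: lspan0 | apply: lspanD].
Qed.

Lemma lspan_seq (T : eqType) (e : T -> V) (l : seq T) v : uniq l ->
  lspan (fun u => exists2 x, x \in l & u = e x) v ->
  exists a : T -> R, v = \sum_(x <- l) a x *: e x.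
Proof.
move=> ul; elim=> [|a _ v' [x xl ->] _ [b ->]].
  by exists (fun=> 0); rewrite big1 // => x _; rewrite scale0r.
exists (fun y => (if y == x then a else 0) + b y).
under [RHS]eq_bigr do rewrite scalerDl.
rewrite big_split; congr (_ + _).
rewrite (bigD1_seq x) //= eqxx big1 ?addr0 // => y /negbTE ->.
by rewrite scale0r.
Qed.

Lemma lspan_explicit (T : eqType) (e : T -> V) (P : T -> Prop) S v :
  (forall u, S u -> exists2 x, P x & u = e x) -> lspan S v ->
  exists2 s : seq (R * T), (forall p, p \in s -> P p.2) & v = \sum_(p <- s) p.1 *: e p.2.
Proof.
move=> SP; elim=> [|a _ v' /SP[x Px ->] _ [s Ps ->]]; first by exists [::]; rewrite ?big_nil.
exists ((a, x) :: s); last by rewrite big_cons.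
by move=> p; rewrite inE => /orP[/eqP->|/Ps].
Qed.

End Span.

Lemma submodule_opp (R : nzRingType) (V : lmodType R) (N : V -> Prop) v :
  is_submodule N -> N v -> N (- v).
Proof. by case=> _ _ NZ Nv; rewrite -scaleN1r; apply: NZ. Qed.

Section VectorSpaces.
Variables (K : fieldType) (V : lmodType K).

Definition kdim (W : V -> Prop) (d : nat) : Prop :=
  exists v : 'I_d -> V,
    [/\ forall i, W (v i),
        forall q, W q -> exists a : 'I_d -> K, q = \sum_i a i *: v i
      & forall a : 'I_d -> K, \sum_i a i *: v i = 0 -> forall i, a i = 0].

(** The coordinates of [v] with respect to [v'] form a d by d' matrix whose rows are independent
    because [v] is free. *)
Lemma kdim_le W d d' : kdim W d -> kdim W d' -> (d <= d')%N.
Proof.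
move=> [v [Wv _ fv]] [v' [Wv' gv' _]].
have [A hA] : exists A : 'I_d -> 'I_d' -> K, forall i, v i = \sum_j A i j *: v' j.
  pose A i := epsilon (inhabits (fun=> 0)) (fun a : 'I_d' -> K => v i = \sum_j a j *: v' j).
  by exists A => i; apply: (epsilon_spec (inhabits (fun=> 0)) _ (gv' _ (Wv i))).
pose M : 'M[K]_(d, d') := \matrix_(i, j) A i j.
suff /eqP <- : row_free M by apply: rank_leq_col.
rewrite -kermx_eq0; apply/rowV0P => x /sub_kermxP xM0; apply/rowP => i.
rewrite mxE; apply: (fv (fun i => x 0 i)).
under eq_bigr do rewrite hA scaler_sumr.
rewrite exchange_big big1 //= => j _.
under eq_bigr do rewrite scalerA.
rewrite -scaler_suml; have /rowP/(_ j) := xM0; rewrite !mxE => xM0j.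
suff -> : \sum_k x 0 k * A k j = 0 by rewrite scale0r.
by rewrite -[RHS]xM0j; apply: eq_bigr => k _; rewrite mxE.
Qed.

Lemma kdim_uniq W d d' : kdim W d -> kdim W d' -> d = d'.
Proof. by move=> h h'; apply/eqP; rewrite eqn_leq !(@kdim_le W). Qed.

(** Induction on the spanning list: the intersections of the [N i] with the span of [s] stabilise.
    If every [N i] meets the coset of [x] modulo that span, subtracting a multiple of such an
    element reduces any vector to the intersections. Otherwise some [N i1] lies in the span of [s],
    and so do all later terms. *)
Lemma chain_stable (s : seq V) (N : nat -> V -> Prop) :
  (forall i, is_submodule (N i)) -> (forall i v, N i.+1 v -> N i v) ->
  (forall i v, N i v -> lspan (fun u => u \in s) v) ->
  exists i0, forall i, (i0 <= i)%N -> forall v, N i0 v -> N i v.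
Proof.
elim: s N => [|x s IHs] N subN decN spanN.
  exists 0%N => i _ v /spanN [|a w u //]; first by case: (subN i).
have dec i j v : (i <= j)%N -> N j v -> N i v.
  elim: j => [|j IHj]; first by rewrite leqn0 => /eqP->.
  by rewrite leq_eqVlt => /orP[/eqP->//|/IHj H /decN].
pose N' i v := N i v /\ lspan (fun u => u \in s) v.
have [|i v [/decN]|i v []//|i0 stab] := IHs N'; first last.
- pose top i q := N i q /\ lspan (fun u => u \in s) (q - x).
  have split_x v : lspan (fun u => u \in x :: s) v ->
      exists a, lspan (fun u => u \in s) (v - a *: x).
    elim=> [|a w u]; first by exists 0; rewrite scale0r subr0; apply: lspan0.
    rewrite inE => /orP[/eqP->|ws] _ [b hb].
      by exists (a + b); rewrite scalerDl opprD addrACA subrr add0r.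
    by exists b; rewrite -addrA; apply: lspanZD.
  case: (classic (forall i, exists q, top i q)) => [alltop|].
    exists i0 => i lei v Nv; have [a va] := split_x _ (spanN _ _ Nv).
    have [q [Nq qx]] := alltop i; have [_ ND NZ] := subN i.
    have [_ ND0 NZ0] := subN i0.
    suff [Nvq _] : N' i (v - a *: q).
      by rewrite -[v](subrK (a *: q)); apply: ND => //; apply: NZ.
    apply: (stab _ lei); split.
      by apply: ND0 => //; apply: submodule_opp => //; apply: NZ0; apply: dec Nq.
    rewrite (_ : v - a *: q = (v - a *: x) + (- a) *: (q - x)).
      by apply: lspanD => //; apply: lspanZ.
    by rewrite scalerBr !scaleNr opprK [- _ + _]addrC addrA subrK.
  move/not_all_ex_not=> [i1 ntop]; exists (maxn i0 i1) => i.
  rewrite geq_max => /andP[le0 le1] v Nv.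
  suff : N' i v by case.
  apply: (stab _ le0); split; first by apply: dec Nv; rewrite leq_maxl.
  have [a va] := split_x _ (spanN _ _ Nv).
  case: (eqVneq a 0) va => [->|a0 va]; first by rewrite scale0r subr0.
  case: ntop; exists (a^-1 *: v); split.
    by have [_ _ NZ] := subN i1; apply: NZ; apply: dec Nv; rewrite leq_maxr.
  by have := lspanZ a^-1 va; rewrite scalerBr scalerA mulVf // scale1r.
- by move=> w; split.
- move=> i; have [N0 ND NZ] := subN i; split.
  + by split=> //; apply: lspan0.
  + by move=> q r [? ?] [? ?]; split; [apply: ND | apply: lspanD].
  + by move=> a q [? ?]; split; [apply: NZ | apply: lspanZ].
Qed.

Section Greedy.
Variables (T : eqType) (e : T -> V) (lt : rel T).
Hypothesis lt_trans : transitive lt.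

Definition greedy (x : T) : Prop := ~ lspan (fun v => exists2 y, lt y x & v = e y) (e x).

(** With the indices sorted by [lt], the last one with a nonzero coefficient would have its vector
    in the span of the vectors of smaller indices. *)
Lemma greedy_free (l : seq T) (a : T -> K) :
  uniq l -> {in l &, forall x y, x != y -> lt x y || lt y x} ->
  (forall x, x \in l -> greedy x) ->
  \sum_(x <- l) a x *: e x = 0 -> forall x, x \in l -> a x = 0.
Proof.
move=> ul tot gl; pose le x y := (x == y) || lt x y.
have le_total : {in mem l &, total le}.
  by move=> x y xl yl; rewrite /le; case: eqVneq => //= /(tot x y xl yl)/orP[->|->]; rewrite ?orbT.
have le_trans : transitive le.
  move=> y x z /orP[/eqP->//|xy] /orP[/eqP<-|yz]; apply/orP; right => //.
  exact: lt_trans yz.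
have := sort_sorted_in le_total (allss l).
rewrite -(perm_big _ (permEl (perm_sort le l))) /= => sl.
suff H (s : seq T) : uniq s -> {subset s <= l} -> sorted le s ->
    \sum_(x <- s) a x *: e x = 0 -> forall x, x \in s -> a x = 0.
  move=> s0 x; rewrite -(mem_sort le); apply: H s0 x; rewrite ?sort_uniq //.
  by move=> x; rewrite mem_sort.
elim/last_ind: s => // s x IHs; rewrite rcons_uniq => /andP[xs us] sub.
rewrite (sorted_pairwise le_trans) pairwise_rcons => /andP[/allP sx ps].
have xl : x \in l by apply: sub; rewrite mem_rcons mem_head.
have sl' : {subset s <= l} by move=> y ys; apply: sub; rewrite mem_rcons inE ys orbT.
rewrite -cats1 big_cat big_seq1 /= => s0.
have ax : a x = 0.
  apply/eqP/negPn/negP => ax0; apply: (gl x xl).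
  have -> : e x = - (a x)^-1 *: \sum_(y <- s) a y *: e y.
    rewrite -[e x]scale1r -(mulVf ax0) -scalerA -[a x *: e x](addKr (\sum_(y <- s) a y *: e y)).
    by rewrite s0 addr0 scalerN scaleNr.
  apply: lspanZ; rewrite big_seq; apply: lspan_sum => y ys; apply/lspanZ/lspan_gen.
  by exists y => //; case/orP: (sx y ys) => // /eqP yx; rewrite yx (negbTE xs) in ys.
move=> y; rewrite cats1 mem_rcons inE => /orP[/eqP->//|].
apply: IHs => //; first by rewrite (sorted_pairwise le_trans).
by move: s0; rewrite ax scale0r addr0.
Qed.

Lemma greedy_kdim (W : V -> Prop) (l : seq T) :
  uniq l -> {in l &, forall x y, x != y -> lt x y || lt y x} ->
  (forall x, x \in l -> greedy x) -> (forall x, x \in l -> W (e x)) ->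
  (forall q, W q -> lspan (fun v => exists2 x, x \in l & v = e x) q) ->
  kdim W (size l).
Proof.
move=> ul tot gl Wl span.
case: l ul tot gl Wl span => [|x0 l0] ul tot gl Wl span.
  exists (fun=> 0); split=> [[]//|q /span/(lspan_seq ul)[a ->]|a _ []//].
  by exists (fun=> 0); rewrite big_nil big_ord0.
move: (x0 :: l0) ul tot gl Wl span => l ul tot gl Wl span.
exists (fun i => e (nth x0 l i)); split.
- by move=> i; apply/Wl/mem_nth.
- move=> q /span/(lspan_seq ul)[a ->].
  by exists (fun i => a (nth x0 l i)); rewrite (big_nth x0) big_mkord.
move=> a s0 i.
pose a' x := if insub (index x l) is Some j then a j else 0.
have a'E (j : 'I_(size l)) : a' (nth x0 l j) = a j.
  by rewrite /a' index_uniq // valK.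
rewrite -a'E; apply: (greedy_free ul tot gl); last exact: mem_nth.
rewrite (big_nth x0) big_mkord -[RHS]s0.
by apply: eq_bigr => j _; rewrite a'E.
Qed.

Lemma greedy_span (P : T -> Prop) x :
  (forall x y, lt y x -> P x -> P y) -> well_founded lt -> P x ->
  lspan (fun v => exists y, [/\ P y, greedy y & v = e y]) (e x).
Proof.
move=> ltP wf; elim/(well_founded_ind wf): x => x IHx Px.
case: (classic (greedy x)) => [gx|/NNPP]; first by apply: lspan_gen; exists x.
apply: lspan_min (lspan_submodule _) _ => _ [y ltyx ->].
by apply: IHx => //; apply: ltP ltyx Px.
Qed.

End Greedy.
End VectorSpaces.

(* An alias of V that carries the vector space structure induced by K -> K[x]. *)
Definition kres (K : fieldType) (r : nat) (V : lmodType {mpoly K[r]}) : Type := V.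

Section Restriction.
Variables (K : fieldType) (r : nat) (V : lmodType {mpoly K[r]}).
HB.instance Definition _ := GRing.Zmodule.on (kres V).
Definition kscale (a : K) (v : kres V) : kres V := a%:MP *: (v : V).
Fact kscaleA a b v : kscale a (kscale b v) = kscale (a * b) v.
Proof. by rewrite /kscale scalerA mpolyCM. Qed.
Fact kscale1 : left_id 1 kscale.
Proof. by move=> v; rewrite /kscale mpolyC1 scale1r. Qed.
Fact kscaleDr : right_distributive kscale +%R.
Proof. by move=> a u v; apply: scalerDr. Qed.
Fact kscaleDl v : {morph kscale^~ v : a b / a + b}.
Proof. by move=> a b; rewrite /kscale mpolyCD; apply: scalerDl. Qed.
HB.instance Definition _ := GRing.Zmodule_isLmodule.Build K (kres V)
  kscaleA kscale1 kscaleDr kscaleDl.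
End Restriction.

Lemma has_dimE (K : fieldType) c X (M : fmodule K c X) n (W : M n -> Prop) d :
  has_dim W d <-> @kdim K (kres (M n)) W d.
Proof. by []. Qed.

(** * Finite homogeneous generation along increasing maps *)

Lemma hom_inj X m n (f g : hom X m n) : sval f =1 sval g -> f = g.
Proof. by move=> eqfg; apply: val_inj; apply/ffunP. Qed.

Lemma is_hom_emb X m n (f : {ffun 'I_m -> 'I_n}) : is_hom OI f -> is_hom X f.
Proof.
case: X => //= /forallP incf; apply/injectiveP => i j.
have lt (k l : 'I_m) : (k < l)%N -> (f k < f l)%N by have /forallP/(_ l)/implyP := incf k.
by move=> eqf; apply: val_inj; case: (ltngtP i j) => // /lt; rewrite eqf ltnn.
Qed.

Definition emb X m n (f : hom OI m n) : hom X m n :=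
  exist (fun h => is_hom X h) _ (is_hom_emb X (svalP f)).

Lemma emb_comp X m n p (g : hom OI n p) (f : hom OI m n) :
  hom_comp (emb X g) (emb X f) = emb X (hom_comp g f).
Proof. exact: hom_inj. Qed.

Lemma sorted_enum_set n (A : {set 'I_n}) : sorted (fun i j : 'I_n => (i < j)%N) (enum A).
Proof.
rewrite /enum_mem; apply: sorted_filter; first by move=> i j k; apply: ltn_trans.
have : sorted (relpre val ltn) (enum 'I_n).
  by rewrite -sorted_map val_enum_ord iota_ltn_sorted.
by rewrite -enumT.
Qed.

Lemma OI_with_image m n (A : {set 'I_n}) : #|A| = m ->
  exists eps : hom OI m n, forall p, (p \in codom (sval eps)) = (p \in A).
Proof.
move=> cA; pose t := tcast cA (enum_tuple A).
have tE (i0 : 'I_n) (i : 'I_m) : tnth t i = nth i0 (enum A) i.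
  by rewrite (tnth_nth i0) val_tcast.
have sE : size (enum A) = m by rewrite -cardE.
have he : is_hom OI [ffun i => tnth t i].
  apply/forallP => i; apply/forallP => j; apply/implyP => ltij; rewrite !ffunE.
  have i0 := tnth t i; rewrite !(tE i0).
  have tr : transitive (fun i j : 'I_n => (i < j)%N) by move=> x y z; apply: ltn_trans.
  by apply: (sorted_ltn_nth tr _ (sorted_enum_set A)); rewrite ?inE ?sE.
exists (exist (fun h => is_hom OI h) _ he) => p /=; rewrite -[RHS]mem_enum.
apply/codomP/idP => [[i ->]|pA]; first by rewrite ffunE (tE p) mem_nth ?sE.
have lti : (index p (enum A) < m)%N by rewrite -[X in (_ < X)%N]sE index_mem.
by exists (Ordinal lti); rewrite ffunE (tE p) nth_index.
Qed.

(** For FI, [eps] is the increasing map onto the image of [f], and [s] sends i to the position of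
    [f i] in that image. For OI, [s] is the identity. *)
Lemma hom_factor X m n (f : hom X m n) :
  exists (s : hom X m m) (eps : hom OI m n), f = hom_comp (emb X eps) s.
Proof.
case: X f => f; first by exists (hom_id OI m), f; apply: hom_inj => i; rewrite !ffunE.
have injf : injective (sval f) by apply/injectiveP; apply: (svalP f).
have [|eps epsE] := @OI_with_image m n (sval f @: [set: 'I_m]).
  by rewrite card_imset // cardsT card_ord.
have fA i : sval f i \in codom (sval eps) by rewrite epsE imset_f.
pose s := [ffun i => iinv (fA i)].
have hs : is_hom FI s.
  apply/injectiveP => i j; rewrite !ffunE => /(congr1 (sval eps)).
  by rewrite !f_iinv => /injf.
exists (exist (fun h => is_hom FI h) _ hs), eps.
by apply: hom_inj => i; rewrite /= !ffunE f_iinv.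
Qed.

(** The list of values of an increasing map is the sorted enumeration of its image. *)
Lemma OI_codom_inj m n (f g : hom OI m n) :
  (forall p, (p \in codom (sval f)) = (p \in codom (sval g))) -> f = g.
Proof.
move=> eqfg; have inc (h : hom OI m n) : sorted (fun i j : 'I_n => (i < j)%N) (codom (sval h)).
  have := sorted_enum_set [set: 'I_m]; rewrite enum_setT -enumT /codom /image_mem.
  apply: (homo_sorted (f := sval h)) => i j.
  by move/forallP/(_ i)/forallP/(_ j)/implyP: (svalP h); apply.
have E : [seq sval f i | i <- enum 'I_m] = [seq sval g i | i <- enum 'I_m].
  apply: (irr_sorted_eq _ _ (inc f) (inc g) eqfg); last by move=> x; apply: ltnn.
  by move=> x y z; apply: ltn_trans.
by apply: hom_inj => i; move/eq_in_map: E; apply; rewrite mem_enum.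
Qed.

Section Generators.
Variables (K : fieldType) (c : nat) (X : OI_or_FI) (M : fmodule K c X).

Definition images (S : forall n, M n -> Prop) n (v : M n) : Prop :=
  exists m (s : M m) (f : hom X m n), S m s /\ v = fmod_map f s.

Lemma images_subfmodule (S : forall n, M n -> Prop) :
  is_subfmodule (fun n => lspan (@images S n)).
Proof.
split=> [n|m n f q]; first exact: lspan_submodule.
elim=> [|a _ v' [p [s [g [Ss ->]]]] _ IH].
  by rewrite -(scale0r (0 : M m)) fmod_mapZ /push comp_mpoly0 scale0r; apply: lspan0.
rewrite fmod_mapD fmod_mapZ; apply: lspanZD IH.
by exists p, s, (hom_comp f g); rewrite fmod_map_comp.
Qed.

Lemma generates_images (S : forall n, M n -> Prop) n (q : M n) :
  generates S -> lspan (@images S n) q.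
Proof.
move/(_ _ (images_subfmodule S)); apply=> m s Ss; apply: lspan_gen.
by exists m, s, (hom_id X m); rewrite fmod_map_id.
Qed.

Definition listed (s : seq {n : nat & M n}) n (q : M n) : Prop :=
  Tagged (fun n => M n) q \in s.

Lemma lspan_images_finite (S : forall n, M n -> Prop) n (q : M n) :
  lspan (@images S n) q ->
  exists2 s : seq {n : nat & M n}, forall t, t \in s -> S (tag t) (tagged t) & lspan (@images (listed s) n) q.
Proof.
elim=> [|a _ v' [m [x [f [Sx ->]]]] _ [s Ss sv']]; first by exists [::] => //; apply: lspan0.
exists (Tagged (fun n => M n) x :: s).
  by move=> t; rewrite inE => /orP[/eqP->|/Ss].
apply: lspanZD; first by exists m, x, f; rewrite /listed mem_head.
apply: lspanS sv' => u [m' [x' [f' [x's ->]]]].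
by exists m', x', f'; rewrite /listed inE x's orbT.
Qed.

(** Each of the finitely many given generators is a combination of images of finitely many elements
    of [S]; these elements together generate. *)
Lemma finite_subgeneration (S : forall n, M n -> Prop) :
  finitely_generated M -> generates S ->
  exists2 s : seq {n : nat & M n}, forall t, t \in s -> S (tag t) (tagged t) & generates (listed s).
Proof.
move=> [F genF] genS.
have [s Ss sF] : exists2 s : seq {n : nat & M n}, forall t, t \in s -> S (tag t) (tagged t) &
    forall t, t \in F -> lspan (@images (listed s) (tag t)) (tagged t).
  elim: F {genF} => [|t F [s Ss sF]]; first by exists [::].
  have [s' Ss' s't] := lspan_images_finite (generates_images (tagged t) genS).
  exists (s' ++ s) => [u|u]; first by rewrite mem_cat => /orP[/Ss'|/Ss].
  have sub s1 : {subset s1 <= s' ++ s} -> forall n (q : M n),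
      lspan (@images (listed s1) n) q -> lspan (@images (listed (s' ++ s)) n) q.
    move=> sub n q; apply: lspanS => v [m [x [f [xs ->]]]].
    by exists m, x, f; split=> //; apply: sub.
  rewrite inE => /orP[/eqP->|/sF].
    by apply: sub s't => x; rewrite mem_cat => ->.
  by apply: sub => x; rewrite mem_cat orbC => ->.
exists s => // N subN sN n q; have [Nmod Nmap] := subN.
apply: (genF N) => // m x xF; apply: lspan_min (sF _ xF) => //= u [p [y [f [ys ->]]]].
exact/Nmap/sN.
Qed.

Lemma OI_generators (G : grading M) :
  finitely_generated M -> generated_nonneg G ->
  exists (r : nat) (d : 'I_r -> nat) (g : forall k, M (d k)) (dg : 'I_r -> nat),
    (forall k, gcomp G (dg k)%:Z (g k)) /\
    forall n (q : M n),
      lspan (fun v => exists k (eps : hom OI (d k) n), v = fmod_map (emb X eps) (g k)) q.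
Proof.
move=> fg [S [genS Shom]]; have [s Ss gens] := finite_subgeneration fg genS.
(* Every generator is replaced by all its images under endomorphisms of its object; by [hom_factor],
   increasing maps then suffice. The induced maps preserve degrees, so the new generators are still
   homogeneous of non-negative degree. *)
pose perms m := enum {: {f : {ffun 'I_m -> 'I_m} | is_hom X f}}.
pose l := [seq Tagged (fun n => M n) (fmod_map (p : hom X (tag t) (tag t)) (tagged t)) |
            t <- s, p <- perms (tag t)].
have lhom k : exists j : nat, gcomp G j%:Z (tagged (tnth (in_tuple l) k)).
  have /allpairsPdep[t [p [ts _ ->]]] := mem_tnth k (in_tuple l).
  have [[] // j _ hj] := Shom _ _ (Ss _ ts); exists j; exact: gcomp_map.
pose dg k := epsilon (inhabits 0%N)
  (fun j : nat => gcomp G j%:Z (tagged (tnth (in_tuple l) k))).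
exists (size l), (fun k => tag (tnth (in_tuple l) k)),
  (fun k => tagged (tnth (in_tuple l) k)), dg; split=> [k|n q].
  exact: (epsilon_spec (inhabits 0%N) _ (lhom k)).
apply: lspanS (generates_images q gens) => _ [m [x [f [xs ->]]]].
have [p [eps ->]] := hom_factor f; rewrite fmod_map_comp.
have /(@tnthP _ _ (in_tuple l))[k Ek] :
    Tagged (fun n => M n) (fmod_map (p : hom X m m) x) \in l.
  apply/allpairsPdep; exists (Tagged (fun n => M n) x), p; split=> //.
  exact: mem_enum.
exists k; move: eps; have -> : fmod_map p x = tagged (Tagged (fun n => M n) (fmod_map p x)) by [].
by rewrite -[m]/(tag (Tagged (fun n => M n) (fmod_map p x))) Ek => eps; exists eps.
Qed.

End Generators.

(** * Words *)

(* The letter (m, b) at position p records the exponents m of the variables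
   x_{i,p} and whether p lies in the image of the map applied to a generator. *)
Notation letter c := ('X_{1..c} * bool)%type.

Section Words.
Variable c : nat.
Implicit Types (a b : letter c) (u v w : seq (letter c)).

Definition wdeg w : nat := \sum_(a <- w) mdeg a.1.

(** Marks are compared first, then exponents in a monomial order. Its invariance under translation
    is what makes standard words stable under division. *)
Definition ltletter a b := (~~ a.2 && b.2) || ((a.2 == b.2) && (a.1 < b.1)%O).

Fixpoint ltlex u v := match u, v with
  | a :: u', b :: v' => ltletter a b || ((a == b) && ltlex u' v')
  | _, _ => false
  end.

Lemma ltletter_trans : transitive ltletter.
Proof.
move=> [m2 b2] [m1 b1] [m3 b3]; rewrite /ltletter /=.
by case: b1 b2 b3 => -[] [] //=; apply: lt_trans.
Qed.

Lemma ltletter_irr : irreflexive ltletter.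
Proof. by move=> [m b]; rewrite /ltletter /= ltxx andbF andbC andbN. Qed.

Lemma ltletter_total a b : a != b -> ltletter a b || ltletter b a.
Proof.
case: a b => m1 b1 [m2 b2]; rewrite xpair_eqE /ltletter /=.
by case: b1 b2 => -[] //=; rewrite ?andbT ?orbT // => /lt_total.
Qed.

Lemma ltletterDr (m m1 m2 : 'X_{1..c}) (b1 b2 : bool) :
  ltletter ((m1 + m)%MM, b1) ((m2 + m)%MM, b2) = ltletter (m1, b1) (m2, b2).
Proof. by rewrite /ltletter /= ltmc_add2l. Qed.

Lemma ltletter_wf : well_founded ltletter.
Proof.
have accF m : Acc ltletter (m, false).
  elim/(well_founded_ind (@ltom_wf c)): m => m IHm; constructor => -[m' b'].
  by case/orP=> /andP[] /=; [ | move/eqP=> -> /IHm].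
move=> [m []]; last exact: accF.
elim/(well_founded_ind (@ltom_wf c)): m => m IHm.
constructor => -[m' [] lt]; last exact: accF.
by apply: IHm; case/orP: lt => /andP[].
Qed.

Lemma ltlex_trans : transitive ltlex.
Proof.
move=> v u; elim: u v => [|a u IHu] [|b v] //= [|d w] //=.
case/orP=> [ab|/andP[/eqP<- uv]]; case/orP=> [bd|/andP[/eqP<- vw]].
- by rewrite (ltletter_trans ab bd).
- by rewrite ab.
- by rewrite bd.
- by rewrite eqxx (IHu _ _ uv vw) orbT.
Qed.

Lemma ltlex_total u v : size u = size v -> u != v -> ltlex u v || ltlex v u.
Proof.
elim: u v => [|a u IHu] [|b v] //= [suv]; rewrite eqseq_cons.
case: eqVneq => [->|/ltletter_total/orP[->|->]]; rewrite ?orbT //= ltletter_irr.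
exact: IHu.
Qed.

Lemma ltlex_cat u1 u2 v1 v2 : size u1 = size u2 ->
  ltlex (u1 ++ v1) (u2 ++ v2) = ltlex u1 u2 || ((u1 == u2) && ltlex v1 v2).
Proof.
elim: u1 u2 => [|a u1 IHu] [|b u2] //= [suv].
by rewrite IHu // eqseq_cons; case: (ltletter a b) => //=; rewrite andb_orr andbA.
Qed.

(** Among words of varying length the lexicographic order has infinite descents such as b, ab, aab,
    hence the condition on sizes. The induction is on the length, then the first letter, then the
    tail. *)
Lemma ltlex_wf : well_founded (fun u v => (size u == size v) && ltlex u v).
Proof.
move=> w; move: {2}(size w) (erefl (size w)) => n; elim: n w => [|n IHn] w.
  by move/size0nil=> ->; constructor => -[|b u] /andP[].
case: w => [|a w] sw; first by discriminate sw.
case: sw => sw; elim/(well_founded_ind ltletter_wf): a w sw => a IHa w sw.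
have accw := IHn w sw; elim: accw sw => {}w _ IHw sw; constructor => -[|b u] /andP[].
  by move=> su; discriminate su.
rewrite /= eqSS => /eqP su /orP[/IHa|/andP[/eqP-> ltuw]].
  by apply; rewrite su.
by apply: IHw; rewrite su // eqxx.
Qed.

Lemma wdeg_cat u v : wdeg (u ++ v) = (wdeg u + wdeg v)%N.
Proof. by rewrite /wdeg big_cat. Qed.

Lemma wdeg_cons a u : wdeg (a :: u) = (mdeg a.1 + wdeg u)%N.
Proof. by rewrite /wdeg big_cons. Qed.

End Words.

Section Index.
Variables (c r : nat) (dg : 'I_r -> nat).
Implicit Types (x y : 'I_r * seq (letter c)).

Definition tdeg x := (dg x.1 + wdeg x.2)%N.

(** Indices are compared only within one width and one degree. There the order is total, which
    suffices because bases are built degree by degree. *)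
Definition ltidx : rel ('I_r * seq (letter c)) := fun x y =>
  [&& size x.2 == size y.2, tdeg x == tdeg y &
      (x.1 < y.1)%N || (x.1 == y.1) && ltlex x.2 y.2].

Lemma ltidx_trans : transitive ltidx.
Proof.
move=> [l v] [k u] [m w] /and3P[/= /eqP suv /eqP duv kl] /and3P[/= /eqP svw /eqP dvw lm].
rewrite /ltidx /= suv svw duv dvw !eqxx /=.
case/orP: kl lm => [kl|/andP[/eqP-> uv]] /orP[lm|/andP[/eqP<- vw]].
- by rewrite (ltn_trans kl lm).
- by rewrite kl.
- by rewrite lm.
- by rewrite eqxx (ltlex_trans uv vw) orbT.
Qed.

Lemma ltidx_total x y : size x.2 = size y.2 -> tdeg x = tdeg y ->
  x != y -> ltidx x y || ltidx y x.
Proof.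
case: x y => [k u] [l v] /= suv duv; rewrite /ltidx /= suv duv !eqxx /= xpair_eqE.
case: (eqVneq k l) => [->|nkl] /=; first by rewrite ltnn /=; apply: ltlex_total.
by case: (ltngtP k l) => // /val_inj ekl; rewrite ekl eqxx in nkl.
Qed.

Lemma ltidx_wf : well_founded ltidx.
Proof.
move=> [k w]; move: {2}(k : nat) (leqnn k) w => n.
elim: n k => [|n IHn] k lekn w.
all: elim/(well_founded_ind (@ltlex_wf c)): w => w IHw; constructor => -[l u].
all: case/and3P=> /= suw _ /orP[ltlk|/andP[/eqP-> ltuw]]; last by apply: IHw; rewrite suw.
  by have := leq_trans ltlk lekn.
by apply: IHn; rewrite -ltnS; apply: leq_trans ltlk lekn.
Qed.

(** Both words undergo the same change at the same position, and the lexicographic comparison does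
    not see it. *)
Lemma ltidx_mul (m : 'X_{1..c}) k u (a : letter c) v l u' (a' : letter c) v' :
  size u' = size u ->
  ltidx (l, u' ++ a' :: v') (k, u ++ a :: v) ->
  ltidx (l, u' ++ ((a'.1 + m)%MM, a'.2) :: v') (k, u ++ ((a.1 + m)%MM, a.2) :: v).
Proof.
case: a a' => [m1 b1] [m2 b2] su /and3P[/= sz dz lt]; apply/and3P; split=> /=.
- by move: sz; rewrite !size_cat.
- move: dz; rewrite /tdeg /= !wdeg_cat !wdeg_cons /= !mdegD !addnA !(addnAC _ (mdeg m)).
  by rewrite eqn_add2r.
move: lt; rewrite !ltlex_cat //= ltletterDr !xpair_eqE.
by rewrite (can_eq (addmK m)).
Qed.

Lemma ltidx_ins (a : letter c) k u v l u' v' : size u' = size u ->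
  ltidx (l, u' ++ v') (k, u ++ v) -> ltidx (l, u' ++ a :: v') (k, u ++ a :: v).
Proof.
move=> su /and3P[/= sz dz lt]; apply/and3P; split=> /=.
- by move: sz; rewrite !size_cat /= su !eqn_add2l.
- move: dz; rewrite /tdeg /= !wdeg_cat !wdeg_cons !addnA !(addnAC _ (mdeg a.1)).
  by rewrite eqn_add2r.
by move: lt; rewrite !ltlex_cat //= ltletter_irr eqxx.
Qed.

End Index.

(** * Standard words *)

Section Monomials.
Variable c : nat.
Implicit Types (u v w : seq (letter c)).

Definition blank : letter c := (0%MM, false).

Definition monom n w : 'X_{1..#|{: 'I_c * 'I_n}|} :=
  [multinom (nth blank w (enum_val s).2).1 (enum_val s).1 | s < #|{: 'I_c * 'I_n}|].

Definition column n (p : nat) (m : 'X_{1..c}) : 'X_{1..#|{: 'I_c * 'I_n}|} :=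
  [multinom (if (enum_val s).2 == p :> nat then m (enum_val s).1 else 0%N)
    | s < #|{: 'I_c * 'I_n}|].

Lemma monom_mul n u (a : letter c) v m :
  monom n (u ++ ((a.1 + m)%MM, a.2) :: v) = (column n (size u) m + monom n (u ++ a :: v))%MM.
Proof.
apply/mnmP => s; rewrite mnmDE !mnmE !nth_cat.
case: (enum_val s) => i p /=; case: ltngtP => //= [ltup|->].
  by rewrite -(subnSK ltup).
by rewrite subnn /= mnmDE addnC.
Qed.

Lemma mdeg_monom n w : size w = n -> mdeg (monom n w) = wdeg w.
Proof.
move=> sw; rewrite mdegE /wdeg (big_nth blank) sw big_mkord.
transitivity (\sum_(p < n) \sum_(i < c) (nth blank w p).1 i)%N; last first.
  by apply: eq_bigr => p _; rewrite mdegE.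
rewrite exchange_big pair_bigA /= (reindex (fun s : 'I_#|{: 'I_c * 'I_n}| => enum_val s)) /=.
  by apply: eq_bigr => s _; rewrite mnmE.
by exists enum_rank => s _; rewrite ?enum_rankK ?enum_valK.
Qed.

Lemma nth_ins u v i : nth blank (u ++ blank :: v) (bump (size u) i) = nth blank (u ++ v) i.
Proof.
rewrite /bump !nth_cat; case: (leqP (size u) i) => [leui|ltiu]; last by rewrite add0n ltiu.
by rewrite add1n ltnNge leqW //= subSn.
Qed.

Lemma is_hom_skip n (p : 'I_n.+1) : is_hom OI [ffun i => lift p i].
Proof.
apply/forallP => i; apply/forallP => j; apply/implyP; rewrite !ffunE /=.
by rewrite !ltnNge leq_bump2.
Qed.

Definition skip n (p : 'I_n.+1) : hom OI n n.+1 :=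
  exist (fun f => is_hom OI f) _ (is_hom_skip p).

(** The map that omits the value [p] leaves column [p] without variables and shifts the later
    columns, which amounts to inserting a blank at position [p]. *)
Lemma push_skip (K : fieldType) X n (p : 'I_n.+1) u v : p = size u :> nat ->
  push (emb X (skip p)) 'X_[monom n (u ++ v)] = 'X_[monom n.+1 (u ++ blank :: v)]
    :> coef_alg K c n.+1.
Proof.
move=> pu; rewrite /push comp_mpolyX.
under eq_bigr do rewrite tnth_mktuple /xvar mpolyXn.
rewrite mprodXE; congr 'X_[_]; apply/mnmP => s; rewrite mnm_sumE mnmE.
rewrite -[s]enum_valK; case: (enum_val s) => i q; rewrite enum_rankK /=.
have E t : (U_(enum_rank ((enum_val t).1, lift p (enum_val t).2)) *+ monom n (u ++ v) t)%MM
      (enum_rank (i, q)) =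
    if ((enum_val t).1 == i) && (lift p (enum_val t).2 == q)
    then (nth blank (u ++ v) (enum_val t).2).1 i else 0%N.
  rewrite mulmnE mnm1E (inj_eq enum_rank_inj) xpair_eqE mnmE.
  by case: eqP => [->|_]; case: eqP; rewrite ?mul1n ?mul0n.
under eq_bigr do rewrite ffunE E.
case: (unliftP p q) => [q' ->|->].
  rewrite /= pu nth_ins (bigD1 (enum_rank (i, q'))) //= enum_rankK /= !eqxx /=.
  rewrite big1 ?addn0 // => t; rewrite (inj_eq lift_inj).
  by case: ifP => // /andP[/eqP<- /eqP<-]; rewrite -surjective_pairing enum_valK eqxx.
rewrite pu nth_cat ltnn subnn /= mnm0E big1 // => t _.
by rewrite [lift _ _ == _]eq_sym (negbTE (neq_lift _ _)) andbF.
Qed.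

End Monomials.

Section Matching.
Variables (c d n : nat).
Implicit Types (u v w : seq (letter c)) (f : hom OI d n).

Definition matches w f : bool :=
  (size w == n) && [forall p : 'I_n, (p \in codom (sval f)) == (nth (blank c) w p).2].

Lemma matchesP w f : reflect
  (size w = n /\ forall p : 'I_n, (p \in codom (sval f)) = (nth (blank c) w p).2)
  (matches w f).
Proof.
apply: (iffP andP) => [[/eqP sw /forallP h]|[sw h]].
  by split=> // p; apply/eqP.
by split; [apply/eqP | apply/forallP => p; apply/eqP].
Qed.

Lemma matches_inj w f f' : matches w f -> matches w f' -> f = f'.
Proof. by move=> /matchesP[_ h] /matchesP[_ h']; apply: OI_codom_inj => p; rewrite h h'. Qed.

Lemma count_marks w : size w = n ->
  count snd w = #|[set p : 'I_n | (nth (blank c) w p).2]|.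
Proof.
move=> sw; rewrite -sum1_count (big_nth (blank c)) sw big_mkord -sum1_card.
by apply: eq_bigl => p; rewrite inE.
Qed.

Lemma matches_count w f : matches w f -> count snd w = d.
Proof.
move=> /matchesP[sw h]; rewrite (count_marks sw).
have injf : injective (sval f) by apply/injectiveP; apply: (@is_hom_emb FI) (svalP f).
rewrite -[RHS]card_ord -(card_codom injf); apply: eq_card => p.
by rewrite inE h.
Qed.

Lemma matches_exists w : size w = n -> count snd w = d -> exists f, matches w f.
Proof.
move=> sw; rewrite (count_marks sw) => /OI_with_image[f fE].
by exists f; apply/matchesP; split=> // p; rewrite fE inE.
Qed.

End Matching.

Section Elements.
Variables (K : fieldType) (c : nat) (X : OI_or_FI) (M : fmodule K c X).
Variables (r : nat) (d : 'I_r -> nat) (g : forall k, M (d k)).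
Notation idx := ('I_r * seq (letter c))%type.
Implicit Types (x y : idx) (u w : seq (letter c)) (k l : 'I_r).

(** The default 0, taken when the marks of the word fit no map, prevents such words from being
    standard. *)
Definition elt n x : M n :=
  if [pick f : {f : {ffun 'I_(d x.1) -> 'I_n} | is_hom OI f} | matches x.2 (f : hom OI _ _)]
  is Some f then 'X_[monom n x.2] *: fmod_map (emb X (f : hom OI _ _)) (g x.1) else 0.

Lemma elt_match n k w (f : hom OI (d k) n) : matches w f ->
  elt n (k, w) = 'X_[monom n w] *: fmod_map (emb X f) (g k).
Proof.
move=> mf; rewrite /elt /=; case: pickP => [f' mf'|/(_ f)]; last by rewrite mf.
by rewrite (matches_inj mf mf').
Qed.

Lemma elt_nomatch n x : ~ (size x.2 = n /\ count snd x.2 = d x.1) -> elt n x = 0.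
Proof.
move=> nm; rewrite /elt; case: pickP => // f mf; case: nm.
by split; [case/matchesP: mf | apply: matches_count mf].
Qed.

Lemma elt_mul n k u (a : letter c) v m :
  elt n (k, u ++ ((a.1 + m)%MM, a.2) :: v) =
  'X_[column n (size u) m] *: elt n (k, u ++ a :: v).
Proof.
have marks : [seq b.2 | b <- u ++ ((a.1 + m)%MM, a.2) :: v] = [seq b.2 | b <- u ++ a :: v].
  by rewrite !map_cat.
have sz : size (u ++ ((a.1 + m)%MM, a.2) :: v) = size (u ++ a :: v).
  by rewrite !size_cat.
case: (classic (size (u ++ a :: v) = n /\ count snd (u ++ a :: v) = d k)) => [[]|nm].
  move=> sw cw; have [f mf] := matches_exists sw cw.
  have mf' : matches (u ++ ((a.1 + m)%MM, a.2) :: v) f.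
    apply/matchesP; split=> [|p]; first by rewrite sz.
    case/matchesP: mf => _ ->; have ltp : (p < size (u ++ a :: v))%N by rewrite sw.
    by rewrite -!(nth_map _ false snd) ?sz // marks.
  by rewrite (elt_match mf) (elt_match mf') scalerA -mpolyXD monom_mul.
rewrite !elt_nomatch ?scaler0 //= sz => -[sw cw]; apply: nm; split=> //.
by rewrite -cw !count_cat.
Qed.

Lemma fmod_map0 m n (f : hom X m n) : fmod_map f (0 : M m) = 0.
Proof. by rewrite -(scale0r (0 : M m)) fmod_mapZ /push comp_mpoly0 scale0r. Qed.

Lemma elt_ins n k u v (p : 'I_n.+1) : p = size u :> nat ->
  elt n.+1 (k, u ++ blank c :: v) = fmod_map (emb X (skip p)) (elt n (k, u ++ v)).
Proof.
move=> pu.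
case: (classic (size (u ++ v) = n /\ count snd (u ++ v) = d k)) => [[]|nm]; last first.
  rewrite !elt_nomatch ?fmod_map0 //= => -[sw cw]; apply: nm.
  by move: sw cw; rewrite !size_cat !count_cat /= addnS => -[].
move=> sw cw; have [f mf] := matches_exists sw cw.
have mf' : matches (u ++ blank c :: v) (hom_comp (skip p) f).
  apply/matchesP; split=> [|q]; first by move: sw; rewrite !size_cat /= addnS => ->.
  case/matchesP: mf => _ fE; case: (unliftP p q) => [q' ->|->].
    rewrite /= pu nth_ins -fE; apply/codomP/codomP => -[i].
      by rewrite !ffunE => /lift_inj ->; exists i.
    by move=> ->; exists i; rewrite !ffunE.
  rewrite /= pu nth_cat ltnn subnn /=; apply/codomP => -[i].
  by rewrite !ffunE; apply/eqP/neq_lift.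
by rewrite (elt_match mf) (elt_match mf') fmod_mapZ push_skip // -emb_comp fmod_map_comp.
Qed.

Definition of_monom n k (f : hom OI (d k) n) (m : 'X_{1..#|{: 'I_c * 'I_n}|}) :
    seq (letter c) :=
  [seq ([multinom m (enum_rank (i, p)) | i < c], p \in codom (sval f)) | p <- enum 'I_n].

Lemma nth_of_monom n k (f : hom OI (d k) n) m (p : 'I_n) :
  nth (blank c) (of_monom f m) p =
  ([multinom m (enum_rank (i, p)) | i < c], p \in codom (sval f)).
Proof. by rewrite (nth_map p) ?size_enum_ord // nth_ord_enum. Qed.

Lemma elt_of_monom n k (f : hom OI (d k) n) m :
  elt n (k, of_monom f m) = 'X_[m] *: fmod_map (emb X f) (g k).
Proof.
rewrite (@elt_match _ _ _ f).
  congr ('X_[_] *: _); apply/mnmP => s; rewrite mnmE nth_of_monom /= mnmE.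
  by rewrite -surjective_pairing enum_valK.
apply/matchesP; split=> [|p]; last by rewrite nth_of_monom.
by rewrite size_map size_enum_ord.
Qed.

Lemma elt_spans n : (forall q : M n,
    lspan (fun v => exists k (f : hom OI (d k) n), v = fmod_map (emb X f) (g k)) q) ->
  forall q : M n, @lspan K (kres (M n)) (fun v => exists x, v = elt n x) q.
Proof.
move=> spanP q; elim: (spanP q) => [|a _ v [k [f ->]] _ IHv]; first exact: lspan0.
apply: (@lspanD _ (kres (M n))) IHv.
rewrite [a in a *: _]mpolyE scaler_suml.
apply: (@lspan_sum _ (kres (M n))) => m _.
rewrite -mul_mpolyC -scalerA -elt_of_monom.
apply: (@lspanZ _ (kres (M n))); apply: lspan_gen; by exists (k, of_monom f m).
Qed.

Variable dg : 'I_r -> nat.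

Definition standard_at n x : Prop := @greedy K (kres (M n)) _ (elt n) (ltidx dg) x.

Definition standard x : Prop := standard_at (size x.2) x.

Lemma standard_neq0 n x : standard_at n x -> elt n x != 0.
Proof. by move=> sx; apply/eqP => x0; apply: sx; rewrite x0; apply: lspan0. Qed.

Lemma standard_count n k w : standard_at n (k, w) -> size w = n /\ count snd w = d k.
Proof.
by move/standard_neq0 => nz; apply: NNPP => ncw; case/eqP: nz; apply: elt_nomatch.
Qed.

Lemma split_word w u v (a : letter c) : size w = size (u ++ a :: v) ->
  exists u' a' v', size u' = size u /\ w = u' ++ a' :: v'.
Proof.
rewrite size_cat /= => sw; have lt : (size u < size w)%N by rewrite sw -addSnnS leq_addr.
exists (take (size u) w), (nth a w (size u)), (drop (size u).+1 w).
by rewrite size_take lt -drop_nth // cat_take_drop.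
Qed.

(** By contraposition: a relation expressing the element of the divisor through smaller words is
    multiplied by the column monomial, and [ltidx_mul] keeps its words smaller. *)
Lemma standard_div n k u (a : letter c) v m :
  standard_at n (k, u ++ ((a.1 + m)%MM, a.2) :: v) -> standard_at n (k, u ++ a :: v).
Proof.
move=> std nstd; apply: std; rewrite elt_mul.
have mono (b : K) (q : M n) : 'X_[column n (size u) m] *: (b%:MP *: q) =
    b%:MP *: ('X_[column n (size u) m] *: q) by rewrite !scalerA mulrC.
move: (elt n (k, u ++ a :: v)) nstd => q.
elim=> [|b _ q' [[l w] lt ->] _ IH]; first by rewrite scaler0; apply: lspan0.
rewrite scalerDr [X in X + _]mono; apply: lspanZD IH; case/and3P: (lt) => /= /eqP sw _ _.
have [u' [a' [v' [su' Ew]]]] := split_word sw.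
exists (l, u' ++ ((a'.1 + m)%MM, a'.2) :: v').
  by apply: ltidx_mul => //; rewrite -Ew.
by rewrite elt_mul su' -Ew.
Qed.

(** By contraposition: the map induced by [skip] inserts a blank into every word of a relation, and
    [ltidx_ins] keeps the order. *)
Lemma standard_del n k u v :
  standard_at n.+1 (k, u ++ blank c :: v) -> standard_at n (k, u ++ v).
Proof.
move=> std nstd; have [sz _] := standard_count std; apply: std.
have ltu : (size u < n.+1)%N by rewrite -sz size_cat /= -addSnnS leq_addr.
have ins := @elt_ins n _ _ _ (Ordinal ltu); rewrite ins //.
have mono (b : K) (q : M n) : fmod_map (emb X (skip (Ordinal ltu))) (b%:MP *: q) =
    b%:MP *: fmod_map (emb X (skip (Ordinal ltu))) q.
  by rewrite fmod_mapZ /push comp_mpolyC.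
move: (elt n (k, u ++ v)) nstd => q.
elim=> [|b _ q' [[l w] lt ->] _ IH]; first by rewrite fmod_map0; apply: lspan0.
rewrite fmod_mapD [X in X + _]mono; apply: lspanZD IH; case/and3P: (lt) => /= /eqP sw _ _.
have [u' [v' [su' Ew]]] : exists u' v', size u' = size u /\ w = u' ++ v'.
  exists (take (size u) w), (drop (size u) w); rewrite cat_take_drop size_takel //.
  by rewrite sw size_cat leq_addr.
exists (l, u' ++ blank c :: v').
  by apply: ltidx_ins => //; rewrite -Ew.
by rewrite Ew ins.
Qed.

Variable G : grading M.
Hypothesis g_hom : forall k, gcomp G (dg k)%:Z (g k).
Hypothesis g_span : forall n (q : M n),
  lspan (fun v => exists k (f : hom OI (d k) n), v = fmod_map (emb X f) (g k)) q.

Lemma elt_hom n x : gcomp G (tdeg dg x)%:Z (elt n x).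
Proof.
case: x => k w.
case: (classic (size w = n /\ count snd w = d k)) => [[sw cw]|nm]; last first.
  by rewrite elt_nomatch //; apply: gcomp0.
have [f mf] := matches_exists sw cw; rewrite (elt_match mf).
rewrite /tdeg /= addnC PoszD -(mdeg_monom sw).
by apply: gcompZ; [rewrite dhomogX | apply: gcomp_map].
Qed.

Lemma gcompN n j (q : M n) : gcomp G j q -> gcomp G j (- q).
Proof.
by move=> hq; rewrite -scaleN1r -[j]add0r; apply: gcompZ hq; rewrite rpredN; apply: dhomog1.
Qed.

Lemma gcompK n j (b : K) (q : M n) : gcomp G j q -> gcomp G j (b%:MP *: q).
Proof.
move=> hq; rewrite -[j]add0r; apply: gcompZ hq; rewrite -[b%:MP]mulr1 mul_mpolyC.
by apply: dhomogZ; apply: dhomog1.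
Qed.

Lemma gcomp_bigsum n j (I : Type) (s : seq I) (P : pred I) (F : I -> M n) :
  (forall i, P i -> gcomp G j (F i)) -> gcomp G j (\sum_(i <- s | P i) F i).
Proof. by move=> hF; apply: big_ind hF; [apply: gcomp0 | apply: gcompD]. Qed.

Lemma gcomp_extract n j (I : eqType) (s : seq I) (F : I -> M n) (e : I -> int) :
  (forall i, i \in s -> gcomp G (e i) (F i)) -> gcomp G j (\sum_(i <- s) F i) ->
  \sum_(i <- s) F i = \sum_(i <- s | e i == j) F i.
Proof.
move=> hF hq; set q := \sum_(i <- s) F i in hq *.
pose t := undup (j :: [seq e i | i <- s]).
(* [u a] is the partial sum in degree [a] minus the component of [q] in that degree, [q] being
   homogeneous of degree [j]. The [u a] add up to zero, so directness makes them vanish. *)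
pose u a := \sum_(i <- s | e i == a) F i - (if a == j then q else 0).
have ut : uniq t by apply: undup_uniq.
have jt : j \in t by rewrite mem_undup mem_head.
have hu a : gcomp G a (u a).
  apply: gcompD; last by apply: gcompN; case: eqP => [->|_] //; apply: gcomp0.
  by rewrite big_seq_cond; apply: gcomp_bigsum => i /andP[/hF hi /eqP<-].
suff u0 : \sum_(a <- t) u a = 0.
  by have := gcomp_direct ut hu u0 jt; rewrite /u eqxx => /eqP; rewrite subr_eq0 => /eqP.
have Eq : \sum_(a <- t) (if a == j then q else 0) = q.
  by rewrite (bigD1_seq j) //= eqxx big1 ?addr0 // => a /negbTE->.
rewrite sumrB Eq (exchange_big_dep predT) //=.
apply/eqP; rewrite subr_eq0; apply/eqP; apply: eq_big_seq => i si.
rewrite -big_filter (_ : [seq a <- t | e i == a] = [:: e i]) ?big_seq1 //.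
have et : e i \in t by rewrite mem_undup inE map_f ?orbT.
have := filter_pred1_uniq ut et; rewrite /pred1 /= => <-.
by apply: eq_filter => a; rewrite /= eq_sym.
Qed.

Lemma gcomp_span n (S : M n -> int -> Prop) j q :
  (forall v a, S v a -> gcomp G a v) -> gcomp G j q ->
  @lspan K (kres (M n)) (fun v => exists a, S v a) q ->
  @lspan K (kres (M n)) (fun v => S v j) q.
Proof.
move=> hS hq /(@lspan_explicit _ (kres (M n)) (M n * int)%type fst (fun p => S p.1 p.2)).
case=> [v [a Sva]|s Ss Eq]; first by exists (v, a).
have {}Eq : q = \sum_(p <- s) p.1%:MP *: p.2.1 := Eq.
rewrite Eq in hq *; rewrite (gcomp_extract (e := fun p => p.2.2) _ hq); last first.
  by move=> p /Ss/hS; apply: gcompK.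
rewrite big_seq_cond; apply: (@lspan_sum _ (kres (M n))) => p /andP[/Ss Sp /eqP<-].
by apply: (@lspanZ _ (kres (M n))); apply: lspan_gen.
Qed.

Lemma gcomp_span_standard n j q : gcomp G j q ->
  @lspan K (kres (M n))
    (fun v => exists x, [/\ standard_at n x, (tdeg dg x)%:Z = j & v = elt n x]) q.
Proof.
move=> hq.
pose S (v : M n) a := exists x, [/\ standard_at n x, (tdeg dg x)%:Z = a & v = elt n x].
apply: (@gcomp_span n S j q) => // [v a [x [_ <- ->]]|]; first exact: elt_hom.
have := elt_spans (@g_span n) q.
apply: lspan_min (lspan_submodule _) _ => _ [x ->].
have := @greedy_span K (kres (M n)) _ (elt n) (ltidx dg) (fun=> True) x.
move=> /(_ (fun _ _ _ _ => I) (@ltidx_wf _ _ dg) I).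
by apply: lspanS => _ [y [_ sy ->]]; exists (tdeg dg y), y.
Qed.

Lemma gcomp_neg n j (q : M n) : j < 0 -> gcomp G j q -> q = 0.
Proof.
move=> j0 /gcomp_span_standard; elim=> // b v u [x [_ Ex _]].
by move: j0; rewrite -Ex.
Qed.

Lemma standard_basis n j (l : seq idx) : uniq l ->
  (forall x, x \in l <-> [/\ size x.2 = n, tdeg dg x = j & standard x]) ->
  has_dim (@gcomp _ _ _ _ G n j%:Z) (size l).
Proof.
move=> ul lE; apply/has_dimE; apply: (@greedy_kdim K (kres (M n)) _ (elt n) (ltidx dg)) => //.
- exact: ltidx_trans.
- by move=> x y /lE[sx dx _] /lE[sy dy _]; apply: ltidx_total; rewrite ?sx ?dx.
- by move=> x /lE[sx _]; rewrite /standard sx.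
- by move=> x /lE[_ dx _]; rewrite -dx; apply: elt_hom.
move=> q /gcomp_span_standard; apply: lspanS => _ [[k w] [sx [dx] ->]].
exists (k, w) => //; apply/lE; have [sw _] := standard_count sx.
by split=> //; rewrite /standard sw.
Qed.

End Elements.

(** * Artinian graded modules and bounded degrees *)

Section Artinian.
Variables (K : fieldType) (c : nat) (X : OI_or_FI) (M : fmodule K c X) (G : grading M).

(** The submodules generated by the homogeneous elements of degree at least i stabilise at some [E].
    An element of degree j >= E then lies in [N j.+1], so it is a combination of elements of degree
    above j and its component of degree j is zero. *)
Lemma artinian_bounded n : artinian_module (M n) ->
  exists E : nat, forall (j : nat) (q : M n), (E <= j)%N -> gcomp G j%:Z q -> q = 0.
Proof.
pose N i := lspan (fun v : M n => exists2 j : nat, (i <= j)%N & gcomp G j%:Z v).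
move=> /(_ N)[i|i q|E stab]; first exact: lspan_submodule.
  by apply: lspanS => v [j ltij hv]; exists j => //; apply: ltnW.
exists E => j q leEj hq.
have : N j.+1 q.
  apply/(stab j.+1 (leqW leEj)); apply: lspan_gen; by exists j.
pose S (v : M n) (a : int) := exists2 i : nat, a = i%:Z & (j < i)%N /\ gcomp G a v.
move=> Nq; have {Nq} : @lspan K (kres (M n)) (fun v => exists a, S v a) q.
  elim: Nq => [|a v v' [i ltji hv] _ IH]; first exact: lspan0.
  apply: (@lspanD _ (kres (M n))) IH; rewrite [a]mpolyE scaler_suml.
  apply: (@lspan_sum _ (kres (M n))) => m _.
  rewrite -mul_mpolyC -scalerA; apply: (@lspanZ _ (kres (M n))); apply: lspan_gen.
  exists (mdeg m + i)%N; exists (mdeg m + i)%N => //; split.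
    exact: leq_trans ltji (leq_addl _ _).
  by rewrite PoszD; apply: gcompZ hv; rewrite dhomogX.
have hS v a : S v a -> gcomp G a v by case=> i _ [].
move/(gcomp_span hS hq); elim=> // b v v' [i eji [lt _]].
by case: eji lt => <-; rewrite ltnn.
Qed.

(** Only finitely many graded pieces are nonzero, so M_n is finite-dimensional over K, and a chain
    of submodules is a chain of subspaces. *)
Lemma bounded_artinian n (d : nat -> nat) E :
  (forall j, j < 0 -> forall q : M n, gcomp G j q -> q = 0) ->
  (forall j : nat, has_dim (@gcomp _ _ _ _ G n j%:Z) (d j)) ->
  (forall j, (E <= j)%N -> d j = 0%N) -> artinian_module (M n).
Proof.
move=> hneg hd dE N subN decN.
have [s hs] : exists s : seq (M n), forall j, (j < E)%N -> forall q, gcomp G j%:Z q ->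
    @lspan K (kres (M n)) (fun u => u \in s) q.
  elim: E {dE} => [|E [s hs]]; first by exists [::].
  have [v [_ gv _]] := hd E; exists (codom v ++ s) => j.
  rewrite ltnS leq_eqVlt => /orP[/eqP->|ltj] q.
    case/gv=> a ->; apply: (@lspan_sum _ (kres (M n))) => i _.
    apply: (@lspanZ _ (kres (M n))); apply: lspan_gen.
    by rewrite mem_cat codom_f.
  by move/(hs j ltj); apply: lspanS => u us; rewrite mem_cat us orbT.
have [||i v _|i0 stab] := @chain_stable K (kres (M n)) s N.
- move=> i; have [N0 ND NZ] := subN i; split=> // a q; exact: NZ.
- exact: decN.
- have [t [u [_ hu ->]]] := gcomp_sum G v.
  apply: (@lspan_sum _ (kres (M n))) => j _.
  case: j (hu j) => [j|j] hj; last by rewrite (hneg _ _ _ hj) //; apply: lspan0.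
  case: (ltnP j E) => [ltj|leE]; first exact: hs hj.
  have [b [_ gb _]] := hd j; have [a ->] := gb _ hj.
  by rewrite big1; [exact: lspan0 | case=> i' lti'; exfalso; rewrite dE in lti'].
exists i0 => i lei q; split; last exact: stab.
elim: i lei => [|i IHi]; first by rewrite leqn0 => /eqP->.
by rewrite leq_eqVlt => /orP[/eqP->//|/IHi H /decN].
Qed.

End Artinian.

(** * Counting standard words of large width *)

Section LargeWidth.
Variables (K : fieldType) (c : nat) (X : OI_or_FI) (M : fmodule K c X) (G : grading M).
Variables (r : nat) (d : 'I_r -> nat) (g : forall k, M (d k)) (dg : 'I_r -> nat).
Hypothesis g_hom : forall k, gcomp G (dg k)%:Z (g k).
Hypothesis g_span : forall n (q : M n),
  lspan (fun v => exists k (f : hom OI (d k) n), v = fmod_map (emb X f) (g k)) q.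
Notation std n x := (standard_at g dg n x).
Implicit Types (u v w : seq (letter c)).

Lemma standard_blank n k u (a : letter c) v :
  std n (k, u ++ a :: v) -> std n (k, u ++ (0%MM, a.2) :: v).
Proof.
move=> sa; apply: (@standard_div _ _ _ _ _ _ _ _ _ _ _ (0%MM, a.2) _ a.1).
by rewrite /= add0m -surjective_pairing.
Qed.

Lemma standard_erase n k u (a : letter c) v : ~~ a.2 ->
  std n.+1 (k, u ++ a :: v) -> std n (k, u ++ v).
Proof. by move=> na /standard_blank; rewrite (negbTE na); apply: standard_del. Qed.

Variables (N E : nat).
Hypothesis ltdN : forall k, (d k < N)%N.
Hypothesis N_bounded : forall (j : nat) (q : M N), (E <= j)%N -> gcomp G j%:Z q -> q = 0.

(* Deleting unmarked letters other than [a] shrinks the word to width [N], where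
   the degree of a standard word is less than [E]. *)
Lemma standard_exponent n k u (a : letter c) v : (N <= n)%N ->
  std n (k, u ++ a :: v) -> (mdeg a.1 < E)%N.
Proof.
elim: n u v => [|n IHn] u v leN sa; rewrite ltnNge; apply/negP => leE.
  by move: leN (ltdN k); rewrite leqn0 => /eqP->.
have [sz ct] := standard_count sa.
move: leN; rewrite leq_eqVlt => /orP[/eqP eN|leN].
  have : elt g N (k, u ++ a :: v) = 0.
    apply: (N_bounded _ (elt_hom g_hom N (k, u ++ a :: v))); rewrite /tdeg wdeg_cat wdeg_cons /=.
    by rewrite (leq_trans leE) // addnA addnCA leq_addr.
  by move/eqP; rewrite eN; apply/negP; apply: standard_neq0 sa.
(* Since [d k < N], the marks cannot fill all positions other than that of [a], so there is an
   unmarked letter to erase. *)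
have : has [pred b : letter c | ~~ b.2] (u ++ v).
  have /eqP : count snd (u ++ v) != size (u ++ v).
    rewrite neq_ltn; apply/orP; left.
    have := leq_trans (ltdN k) leN; rewrite -ct.
    move: sz; rewrite !size_cat !count_cat /= addnS => -[->].
    by rewrite addnCA; apply: leq_ltn_trans; rewrite leq_addl.
  by move=> /eqP; rewrite -all_count -has_predC.
move=> {sz ct}; rewrite has_cat => /orP[] /hasP[b bw nb]; apply/negP: leE; rewrite -ltnNge.
  case/splitPr: bw sa => s1 s2 sa.
  have sa' : std n (k, (s1 ++ s2) ++ a :: v).
    by move: sa; rewrite -!catA; apply: (standard_erase nb).
  exact: IHn sa'.
case/splitPr: bw sa => s1 s2 sa; have sa' : std n (k, u ++ a :: s1 ++ s2).
  by move: sa; rewrite -cat_cons catA => /(standard_erase nb); rewrite -catA.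
exact: IHn sa'.
Qed.

Definition small_letters : seq (letter c) :=
  [seq (bmnm m, b) | m <- enum {: 'X_{1..c < E}}, b <- [:: true; false]].

Lemma mem_small_letters (a : letter c) : (a \in small_letters) = (mdeg a.1 < E)%N.
Proof.
apply/allpairsP/idP => [[[m b] /= [_ _ ->]]|lta]; first exact: bmdeg.
exists (BMultinom lta, a.2); rewrite /= mem_enum -surjective_pairing.
by split=> //; case: a.2.
Qed.

Lemma small_letters_uniq : uniq small_letters.
Proof.
apply: allpairs_uniq => //; first exact: enum_uniq.
by move=> [m b] [m' b'] _ _ /= [/val_inj -> ->].
Qed.

(** The restriction to [small_letters] makes the alphabet finite; by [standard_exponent] it excludes
    no standard word of width at least [N]. *)
Definition std_lang k : pred (seq (letter c)) :=
  fun w => pbool (std (size w) (k, w)) && all (mem small_letters) w.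

(** The last clause, turning an unmarked letter into a blank, makes the blank a loop as soon as
    there is any loop. *)
Definition std_class (e : nat) (L : pred (seq (letter c))) : Prop :=
  [/\ forall w, L w -> {subset w <= small_letters},
      forall w, L w -> count snd w = e,
      forall u a v, ~~ a.2 -> L (u ++ a :: v) -> L (u ++ v)
    & forall u a v, ~~ a.2 -> L (u ++ a :: v) -> L (u ++ blank c :: v)].

Lemma std_lang_class k : std_class (d k) (std_lang k).
Proof.
split=> [w /andP[_ /allP]|w /andP[/pboolP sw _]|u a v na|u a v na] //.
- by case: (standard_count sw).
- case/andP=> /pboolP sw aw; apply/andP; split.
    apply/pboolP; apply: (standard_erase na); move: sw.
    by rewrite !size_cat /= addnS.
  by move: aw; rewrite !all_cat /= => /andP[-> /andP[_]].
- case/andP=> /pboolP sw aw; apply/andP; split.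
    apply/pboolP; move: (standard_blank sw); rewrite (negbTE na).
    by rewrite !size_cat.
  move: aw; rewrite !all_cat /= => /andP[-> /andP[ha ->]]; rewrite andbT /=.
  by move: ha; rewrite /= !mem_small_letters mdeg0; apply: leq_ltn_trans.
Qed.

Lemma std_class_quot e L a : std_class e L -> a \in small_letters -> ~~ a.2 ->
  std_class e (quot a L).
Proof.
move=> [La Lc Ld Lb] _ na; split=> [w /La sub b bw|w /Lc|u b v nb|u b v nb].
- by apply: sub; rewrite inE bw orbT.
- by rewrite /= (negbTE na).
- exact: (Ld (a :: u)).
- exact: (Lb (a :: u)).
Qed.

Lemma std_class_quot_marked e L a : std_class e.+1 L -> a \in small_letters -> a.2 ->
  std_class e (quot a L).
Proof.
move=> [La Lc Ld Lb] _ ma; split=> [w /La sub b bw|w /Lc|u b v nb|u b v nb].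
- by apply: sub; rewrite inE bw orbT.
- by rewrite /= ma => -[].
- exact: (Ld (a :: u)).
- exact: (Lb (a :: u)).
Qed.

Definition letter_weight (a : letter c) : {poly int} := 'X^(mdeg a.1).

Definition admissible (f : {poly int}) : Prop := 0 < f.[1] /\ f.[0] = 1.

(** f(1) is the number of loops. The blank is one of them, and every other unmarked letter has
    positive degree, so f(0) = 1. *)
Lemma std_loop_admissible f :
  loop_weight small_letters snd letter_weight std_class f -> admissible f.
Proof.
move=> [e [L [[La Lc Ld Lb] [w Lw] ln0 ->]]]; set s := loops _ _ _ in ln0 *.
have us : uniq s by rewrite filter_uniq // small_letters_uniq.
split.
  rewrite horner_sum; case: s ln0 {us} => // a s _; rewrite big_cons hornerXn expr1n.
  rewrite ltr_pwDl // sumr_ge0 // => b _; rewrite hornerXn expr1n.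
  exact: ler01.
have loopE a : a \in s -> ~~ a.2 /\ forall u, L (a :: u) = L u.
  by rewrite mem_filter => /andP[/andP[na /pboolP qa] _].
have bs : blank c \in s.
  have [a sa] : exists a, a \in s by case: (s) ln0 => // a *; exists a; apply: mem_head.
  have [na La'] := loopE a sa.
  rewrite mem_filter mem_small_letters mdeg0 /=; apply/andP; split.
    apply/pboolP => u; apply/idP/idP => [|Lu]; first exact: (Ld [::]).
    by apply: (Lb [::] a) => //=; rewrite La'.
  move: sa; rewrite mem_filter mem_small_letters => /andP[_].
  exact: leq_ltn_trans.
rewrite horner_sum (bigD1_seq (blank c)) //= hornerXn mdeg0 expr0 big1_seq ?addr0 //.
move=> a /andP[ab /loopE[na _]]; rewrite hornerXn expr0n mdeg_eq0.
case: eqP => // a0; case/eqP: ab; case: a a0 na {Lw} => m b /= -> /negbTE ->.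
by [].
Qed.

(** For widths from [N] on this polynomial in t is the Hilbert series of M_n, by
    [std_series_dim]. *)
Definition std_series n : {poly int} :=
  \sum_(k < r) 'X^(dg k) * lang_series small_letters letter_weight (std_lang k) n.

Lemma std_series_rational : rational_series admissible std_series.
Proof.
apply: rational_sum => k _.
have [fs [p [gfs Ep]]] : rational_series (loop_weight small_letters snd letter_weight std_class)
    (lang_series small_letters letter_weight (std_lang k)).
  apply: lang_rational (std_lang_class k) => e L.
  - by move=> w [La _ _ _]; apply: La.
  - by move=> w [_ Lc _ _]; apply: Lc.
  - by move=> u a v [_ _ Ld _]; apply: Ld.
  - by move=> a; apply: std_class_quot.
  - by move=> a; apply: std_class_quot_marked.
apply: (@eq_rational_series _ _ (psmul ('X^(dg k))%:P
    (lang_series small_letters letter_weight (std_lang k)))).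
  by move=> n; rewrite psmulC.
apply: rational_psmul; exists fs, p; split=> // f /gfs.
exact: std_loop_admissible.
Qed.

Lemma prod_letter_weight w : \prod_(a <- w) letter_weight a = 'X^(wdeg w).
Proof.
elim: w => [|a w IHw]; first by rewrite big_nil /wdeg big_nil.
by rewrite big_cons IHw wdeg_cons exprD.
Qed.

Lemma std_series_dim n (j : nat) : (N <= n)%N ->
  exists2 e : nat, has_dim (@gcomp _ _ _ _ G n j%:Z) e & (std_series n)`_j = e%:R.
Proof.
move=> leN.
pose F k := [seq w <- words small_letters n | std_lang k w && (tdeg dg (k, w) == j)].
pose l := [seq (k, w) | k <- enum 'I_r, w <- F k].
exists (size l).
  apply: (standard_basis g_hom g_span) => [|x].
    apply: allpairs_uniq_dep; first exact: enum_uniq.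
      by move=> k _; apply/filter_uniq/words_uniq/small_letters_uniq.
    by move=> [k w] [k' w'] _ _ /= [-> ->].
  split=> [/allpairsPdep[k [w [_]]]|].
    rewrite mem_filter mem_words => /andP[/andP[/andP[/pboolP sw _] /eqP dw]].
    by case/andP=> /eqP szw _ ->.
  case: x => k w [/= sw dw st]; apply/allpairsPdep; exists k, w; split=> //.
    by rewrite mem_enum.
  have aw : all (mem small_letters) w.
    apply/allP => a aw; rewrite /= mem_small_letters.
    case/splitPr: aw sw st => s1 s2 sw; rewrite /standard /= sw.
    exact: standard_exponent leN.
  rewrite mem_filter mem_words sw eqxx /= dw eqxx /std_lang aw !andbT.
  by apply/pboolP; rewrite sw; rewrite /standard /= sw in st.
rewrite size_allpairs_dep sumnE big_map big_enum /= natr_sum coef_sum.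
apply: eq_bigr => k _; rewrite /lang_series mulr_sumr coef_sum -sum1_size.
rewrite natr_sum big_filter [RHS]big_mkcondr; apply: eq_bigr => w _.
rewrite prod_letter_weight -exprD coefXn eq_sym.
by case: eqP.
Qed.

End LargeWidth.

(** * Counting standard words of fixed width *)

Section SortedWords.
Variable V : finType.

Definition rank_le : rel V := fun a b => (enum_rank a <= enum_rank b)%N.

Lemma rank_le_trans : transitive rank_le.
Proof. by move=> a b e; apply: leq_trans. Qed.

Lemma rank_le_total : total rank_le.
Proof. by move=> a b; apply: leq_total. Qed.

Lemma rank_le_anti : antisymmetric rank_le.
Proof.
by move=> a b; rewrite /rank_le -eqn_leq => /eqP/val_inj/enum_rank_inj.
Qed.

Lemma sorted_rank_inj x y : sorted rank_le x -> sorted rank_le y ->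
  (forall a, count_mem a x = count_mem a y) -> x = y.
Proof.
move=> sx sy exy; apply: (sorted_eq rank_le_trans rank_le_anti sx sy).
by apply/allP => a _; apply/eqP.
Qed.

Lemma sorted_rank_exists (m : V -> nat) :
  exists2 x, sorted rank_le x & forall a, count_mem a x = m a.
Proof.
exists (sort rank_le (flatten [seq nseq (m a) a | a <- enum V])).
  exact: sort_sorted rank_le_total _.
move=> a; rewrite (permP (permEl (perm_sort _ _))) count_flatten sumnE 2!big_map.
rewrite big_enum (bigD1 a) //= count_nseq /= eqxx mul1n big1 ?addn0 // => b.
by rewrite count_nseq /= => /negbTE->.
Qed.

End SortedWords.

Section FixedWidth.
Variables (K : fieldType) (c : nat) (X : OI_or_FI) (M : fmodule K c X) (G : grading M).
Variables (r : nat) (d : 'I_r -> nat) (g : forall k, M (d k)) (dg : 'I_r -> nat).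
Hypothesis g_hom : forall k, gcomp G (dg k)%:Z (g k).
Hypothesis g_span : forall n (q : M n),
  lspan (fun v => exists k (f : hom OI (d k) n), v = fmod_map (emb X f) (g k)) q.
Variable n : nat.
Notation std x := (standard_at g dg n x).
Notation var := ('I_n * 'I_c)%type.

(* A monomial is encoded as the sorted sequence of its variables. *)
Definition decode (tau : n.-tuple bool) (x : seq var) : seq (letter c) :=
  [seq ([multinom count_mem (p, i) x | i < c], tnth tau p) | p <- enum 'I_n].

Lemma size_decode tau x : size (decode tau x) = n.
Proof. by rewrite size_map size_enum_ord. Qed.

Lemma nth_decode tau x (p : 'I_n) : nth (blank c) (decode tau x) p =
  ([multinom count_mem (p, i) x | i < c], tnth tau p).
Proof. by rewrite (nth_map p) ?size_enum_ord // nth_ord_enum. Qed.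

Lemma wdeg_decode tau x : wdeg (decode tau x) = size x.
Proof.
rewrite /wdeg big_map big_enum /=.
under eq_bigr => p _ do (rewrite mdegE; under eq_bigr do rewrite mnmE).
rewrite pair_bigA /=; under eq_bigr do rewrite -surjective_pairing.
elim: x => [|a x IHx]; first by rewrite big1.
rewrite /= big_split /= IHx (bigD1 a) //= eqxx big1 // => b.
by rewrite eq_sym => /negbTE->.
Qed.

Lemma decode_inj tau tau' x x' : sorted (@rank_le var) x -> sorted (@rank_le var) x' ->
  decode tau x = decode tau' x' -> tau = tau' /\ x = x'.
Proof.
move=> sx sx' E.
have Ep (p : 'I_n) := congr1 (fun w => nth (blank c) w p) E.
split; first by apply: eq_from_tnth => p; move: (Ep p); rewrite !nth_decode => -[].
apply: sorted_rank_inj => // -[p i]; have := congr1 (fun b : letter c => b.1 i) (Ep p).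
by rewrite /= !nth_decode /= !mnmE.
Qed.

Lemma decode_surj w : size w = n ->
  exists tau, exists2 x, sorted (@rank_le var) x & w = decode tau x.
Proof.
move=> sw.
have [x sx cx] := sorted_rank_exists (fun a : var => (nth (blank c) w a.1).1 a.2).
exists [tuple (nth (blank c) w p).2 | p < n], x => //.
apply: (@eq_from_nth _ (blank c)); rewrite ?size_decode // sw => p ltp.
rewrite -[p]/(val (Ordinal ltp)) nth_decode tnth_mktuple.
rewrite [LHS]surjective_pairing; congr (_, _).
by apply/mnmP => i; rewrite mnmE cx.
Qed.

(** Removing one occurrence of a variable divides the monomial by it, so [standard_div] applies. *)
Lemma standard_decode_del k tau u a v :
  std (k, decode tau (u ++ a :: v)) -> std (k, decode tau (u ++ v)).
Proof.
case: a => p i.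
have ep : p \in enum 'I_n by rewrite mem_enum.
rewrite /decode; case/splitPr: ep (enum_uniq 'I_n) => s1 s2.
rewrite cat_uniq /= negb_or => /and3P[_ /andP[ps1 _] /andP[ps2 _]].
have same (s : seq 'I_n) : p \notin s ->
  [seq ([multinom count_mem (q, j) (u ++ (p, i) :: v) | j < c], tnth tau q) | q <- s] =
  [seq ([multinom count_mem (q, j) (u ++ v) | j < c], tnth tau q) | q <- s].
  move=> ps; apply/eq_in_map => q qs; congr (_, _); apply/mnmP => j.
  rewrite !mnmE !count_cat /= xpair_eqE; case: eqP => [epq|//].
  by rewrite epq qs in ps.
rewrite !map_cat /= !same //.
have -> : [multinom count_mem (p, j) (u ++ (p, i) :: v) | j < c] =
    ([multinom count_mem (p, j) (u ++ v) | j < c] + U_(i))%MM.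
  apply/mnmP => j; rewrite mnmDE !mnmE !count_cat /= xpair_eqE eqxx /=.
  by rewrite addnCA addnC.
exact: (@standard_div _ _ _ _ _ _ _ _ _ _ _ (_, _)).
Qed.

Definition mono_lang k tau : pred (seq var) :=
  fun x => sorted (@rank_le var) x && pbool (std (k, decode tau x)).

Definition mono_class (e : nat) (L : pred (seq var)) : Prop :=
  [/\ e = 0%N, forall x, L x -> sorted (@rank_le var) x
    & forall u a v, L (u ++ a :: v) -> L (u ++ v)].

Lemma mono_lang_class k tau : mono_class 0 (mono_lang k tau).
Proof.
split=> // [x /andP[]//|u a v /andP[sx /pboolP st]].
apply/andP; split; last by apply/pboolP; apply: standard_decode_del st.
apply: subseq_sorted sx; first exact: rank_le_trans.
by rewrite cat_subseq ?subseq_cons.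
Qed.

Lemma mono_class_quot e L a : mono_class e L -> mono_class e (quot a L).
Proof.
move=> [e0 Ls Ld]; split=> // [x /Ls /path_sorted //|u b v].
exact: (Ld (a :: u)).
Qed.

(** The series variable is now t: the degree of a monomial is the length of its word, so the letters
    carry no further weight. *)
Definition unit_weight (a : var) : rat := 1.

(** For loops a, b and a word w of L, both abw and baw lie in L and are sorted, so a = b. The single
    loop has weight 1 and contributes the factor 1 - t. *)
Lemma mono_loop_weight f :
  loop_weight (enum {: var}) pred0 unit_weight mono_class f -> f = 1.
Proof.
move=> [e [L [[_ Ls _] [w Lw] ln0 ->]]]; set s := loops _ _ _ in ln0 *.
have us : uniq s by rewrite filter_uniq // enum_uniq.
have loopE a u : a \in s -> L (a :: u) = L u.
  by rewrite mem_filter => /andP[/pboolP qa _]; apply: qa.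
have le a b : a \in s -> b \in s -> rank_le a b.
  move=> sa sb; have /Ls /= /andP[//] : L [:: a, b & w] by rewrite !loopE.
case: s ln0 us loopE le => // a [|b s] _ us loopE le; first by rewrite big_seq1.
have eab : a = b by apply: rank_le_anti; rewrite !le // ?inE ?eqxx ?orbT.
by move: us; rewrite eab /= inE eqxx.
Qed.

Lemma lang_series_unit (L : pred (seq var)) m :
  lang_series (enum {: var}) unit_weight L m =
  (size [seq x <- words (enum {: var}) m | L x])%:R.
Proof.
rewrite -sum1_size natr_sum big_filter; apply: eq_bigr => x _.
by rewrite big1.
Qed.

(** Standard words of width [n] are split according to the generator and the pattern of marks. Each
    of these finitely many classes is a language of sorted words closed under deletion, shifted by
    the degree of the generator. *)
Lemma fixed_width_rational : exists dm : nat -> nat,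
  (forall j : nat, has_dim (@gcomp _ _ _ _ G n j%:Z) (dm j)) /\
  rational_series (fun f : rat => f = 1) (fun j => (dm j)%:R).
Proof.
pose F (j : nat) (kt : 'I_r * n.-tuple bool) := if (dg kt.1 <= j)%N
  then [seq x <- words (enum {: var}) (j - dg kt.1) | mono_lang kt.1 kt.2 x] else [::].
pose l j := [seq (kt.1, decode kt.2 x) | kt <- enum {: 'I_r * n.-tuple bool}, x <- F j kt].
have memF j kt x : x \in F j kt ->
    (dg kt.1 + size x)%N = j /\ mono_lang kt.1 kt.2 x.
  rewrite /F; case: leqP => // lej; rewrite mem_filter mem_words.
  by case/and3P=> Lx /eqP -> _; rewrite subnKC.
exists (fun j => size (l j)); split=> [j|].
  apply: (standard_basis g_hom g_span) => [|x].
    apply: allpairs_uniq_dep; first exact: enum_uniq.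
      move=> kt _; rewrite /F; case: ifP => // _.
      exact/filter_uniq/words_uniq/enum_uniq.
    move=> p1 p2 /allpairsPdep[[k t] [x [_ /memF[_ /andP[sx _]] ->]]].
    move=> /allpairsPdep[[k' t'] [x' [_ /memF[_ /andP[sx' _]] ->]]] /= [-> /decode_inj].
    by case=> // -> ->.
  split=> [/allpairsPdep[[k t] [y [_ /memF[/= dy /andP[_ /pboolP sy]] ->]]]|].
    by rewrite /= size_decode /tdeg /= wdeg_decode /standard /= size_decode.
  case: x => k w [/= sw dw st]; have [t [y sy Ew]] := decode_surj sw.
  apply/allpairsPdep; exists (k, t), y; rewrite mem_enum Ew; split=> //.
  move: dw; rewrite /tdeg Ew wdeg_decode /= /F /= => <-.
  rewrite leq_addr addKn mem_filter mem_words eqxx /=; apply/andP; split.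
    rewrite /mono_lang sy /=; apply/pboolP; rewrite -Ew.
    by rewrite /standard /= sw in st.
  by apply/allP => a _; rewrite /= mem_enum.
apply: (@eq_rational_series _ _ (fun j => \sum_(kt : 'I_r * n.-tuple bool)
    psmul 'X^(dg kt.1) (lang_series (enum {: var}) unit_weight (mono_lang kt.1 kt.2)) j)).
  move=> j; rewrite size_allpairs_dep sumnE big_map big_enum natr_sum.
  apply: eq_bigr => kt _; rewrite psmul_Xn /F; case: ifP => // _.
  by rewrite lang_series_unit.
apply: rational_sum => kt _; apply: rational_psmul.
have [fs [p [gfs Ep]]] : rational_series
    (loop_weight (enum {: var}) pred0 unit_weight mono_class)
    (lang_series (enum {: var}) unit_weight (mono_lang kt.1 kt.2)).
  apply: lang_rational (mono_lang_class _ _) => e L.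
  - by move=> x _ _ a _; rewrite mem_enum.
  - by move=> x [-> _ _] _; rewrite count_pred0.
  - by move=> u a v [_ _ Ld] _; apply: Ld.
  - by move=> a cL _ _; apply: mono_class_quot.
  - by [].
by exists fs, p; split=> // f /gfs; apply: mono_loop_weight.
Qed.

End FixedWidth.

(** * Expansions of rational functions *)

(** If [i0] is the lowest exponent of [q], coefficient [i0 + k] of the product reduces to
    [q_i0 * u k] once the earlier values of [u] are known to vanish. *)
Lemma psmul_inj (R : idomainType) (q : {poly R}) (a b : nat -> R) :
  q != 0 -> psmul q a =1 psmul q b -> a =1 b.
Proof.
move=> q0 eqab.
suff inj0 u : (forall k, psmul q u k = 0) -> forall k, u k = 0.
  move=> k; apply/eqP; rewrite -subr_eq0; apply/eqP; move: k; apply: inj0 => k.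
  rewrite /psmul; under eq_bigr do rewrite mulrBr.
  by rewrite sumrB [X in X - _]eqab subrr.
move=> u0 k.
have [i0 qi0 qmin] : exists2 i0, q`_i0 != 0 & forall i, (i < i0)%N -> q`_i = 0.
  have ex : exists i, q`_i != 0 by exists (size q).-1; rewrite -lead_coefE lead_coef_eq0.
  exists (ex_minn ex); case: ex_minnP => // i0 _ mini i lti; apply/eqP/negPn/negP.
  by move/mini; rewrite leqNgt lti.
elim/ltn_ind: k => k IHk; have := u0 (i0 + k)%N.
have lti0 : (i0 < (i0 + k).+1)%N by rewrite ltnS leq_addr.
rewrite /psmul (bigD1 (Ordinal lti0)) //= addKn big1 ?addr0 => [/eqP|[i lti] /= nei].
  by rewrite mulf_eq0 (negbTE qi0) /= => /eqP.
have {}nei : i != i0 by rewrite -val_eqE in nei.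
case: (ltngtP i i0) nei => // [/qmin->|lt0i] _; first by rewrite mul0r.
rewrite IHk ?mulr0 //.
have lek : (i - i0 <= k)%N by rewrite leq_subLR -ltnS.
by rewrite -(subnKC (ltnW lt0i)) subnDl ltn_subrL subn_gt0 lt0i (leq_trans _ lek) // subn_gt0.
Qed.

Lemma psmul_map (R S : nzRingType) (phi : {rmorphism R -> S}) q a k :
  psmul (map_poly phi q) (fun i => phi (a i)) k = phi (psmul q a k).
Proof.
by rewrite rmorph_sum; apply: eq_bigr => i _; rewrite coef_map rmorphM.
Qed.

Section Laurent.
Variable F : fieldType.
Implicit Types (a : int -> F) (b : nat -> F) (p q : {poly F}).

Lemma laurent_sumE a q (m : nat) : (forall n, a (Negz n) = 0) ->
  \sum_(i < size q) q`_i * a (m%:Z - i%:Z) = psmul q (fun n => a n%:Z) m.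
Proof.
(* Both sums are padded to a common length; the extra terms vanish because [i] is beyond the size of
   [q] or the index of [a] is negative. *)
move=> a0; pose S := \sum_(i < maxn (size q) m.+1) q`_i * a (m%:Z - i%:Z).
transitivity S.
  rewrite (big_ord_widen (maxn (size q) m.+1) (fun i => q`_i * a (m%:Z - i%:Z))) ?leq_maxl //.
  rewrite big_mkcond; apply: eq_bigr => i _; case: ltnP => // /(nth_default 0) ->.
  by rewrite mul0r.
rewrite /psmul; under [RHS]eq_bigr => i _ do rewrite -subzn -1?ltnS //.
rewrite (big_ord_widen (maxn (size q) m.+1) (fun i => q`_i * a (m%:Z - i%:Z))) ?leq_maxr //.
rewrite [RHS]big_mkcond; apply: eq_bigr => i _; case: ltnP => // ltmi.
have -> : m%:Z - i%:Z = Negz (i - m).-1.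
  by rewrite NegzE prednK ?subn_gt0 // -subzn ?opprB // ltnW.
by rewrite a0 mulr0.
Qed.

Lemma laurent_of_series a b p q :
  (forall n : nat, a n%:Z = b n) -> (forall n, a (Negz n) = 0) -> q != 0 ->
  (forall k, psmul q b k = p`_k) -> laurent_expansion a (p%:F / q%:F).
Proof.
move=> ab a0 q0 qb; split; first by exists 0; case=> // n _.
exists p, q; split=> // -[m|m].
  by rewrite laurent_sumE // -qb; apply: eq_psmul.
rewrite big1 // => i _.
have -> : Negz m - i%:Z = Negz (m + i) by rewrite !NegzE -opprD -PoszD.
by rewrite a0 mulr0.
Qed.

Lemma series_of_laurent a (x : {fraction {poly F}}) :
  (forall n, a (Negz n) = 0) -> laurent_expansion a x ->
  exists p q, [/\ q != 0, x = p%:F / q%:F & forall k, psmul q (fun n => a n%:Z) k = p`_k].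
Proof.
move=> a0 [_ [p [q [q0 -> E]]]]; exists p, q; split=> // k.
by rewrite -laurent_sumE // (E k).
Qed.

Lemma fraction_eq (p q p' q' : {poly F}) : q != 0 -> q' != 0 ->
  p%:F / q%:F = p'%:F / q'%:F -> p * q' = p' * q.
Proof.
move=> q0 q'0 /eqP; rewrite eqr_div ?tofrac_eq0 // -!tofracM tofrac_eq.
by move/eqP.
Qed.

End Laurent.

HB.instance Definition _ := GRing.RMorphism.copy Zt_Qt
  ((@FracField.tofrac {poly rat}) \o map_poly (intr : int -> rat)).

Lemma Zt_Qt_inj : injective Zt_Qt.
Proof.
move=> p q /eqP; rewrite tofrac_eq => /eqP; apply: map_inj_poly => //.
exact: intr_inj.
Qed.

Lemma Zst_Qts_geom_prod (fs : seq {poly int}) :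
  Zst_Qts (geom_prod fs) = \prod_(f <- fs) (1 - (Zt_Qt f)%:P * 'X).
Proof.
rewrite /Zst_Qts /geom_prod rmorph_prod; apply: eq_bigr => f _.
by rewrite rmorphB rmorph1 -mul_polyC rmorphM /= map_polyC map_polyX.
Qed.

(** Up to sign the leading coefficient in s is the product of the f's; pseudo-division by this
    polynomial is the source of the factor [f_1 ... f_b]^e. *)
Lemma geom_prod_lead (R : idomainType) (fs : seq R) : (forall f, f \in fs -> f != 0) ->
  size (geom_prod fs) = (size fs).+1 /\
  lead_coef (geom_prod fs) = (-1) ^+ size fs * \prod_(f <- fs) f.
Proof.
rewrite /geom_prod; elim: fs => [|f fs IHfs] fs0.
  by rewrite !big_nil size_poly1 lead_coef1 mulr1.
have f0 : f != 0 by rewrite fs0 ?mem_head.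
have [] := IHfs; first by move=> g gs; rewrite fs0 // inE gs orbT.
rewrite !big_cons => sz lc.
have E : 1 - f *: 'X = - f *: 'X + 1%:P by rewrite addrC scaleNr.
have szf : size (1 - f *: 'X) = 2.
  by rewrite E -mul_polyC size_MXaddC polyC_eq0 size_polyC oppr_eq0 (negbTE f0).
have lcf : lead_coef (1 - f *: 'X) = - f.
  by rewrite lead_coefE szf /= coefB coef1 coefZ coefX mulr1 sub0r.
split; last by rewrite lead_coefM lcf lc exprS; ring.
by rewrite size_mul ?sz ?szf // -size_poly_eq0 ?szf ?sz.
Qed.

(** * The shape of the Hilbert series *)

Definition dimZ (dm : nat -> nat) (j : int) : nat := if j is Posz m then dm m else 0%N.

Lemma nonneg_horner1_eq0 (p : {poly int}) :
  (forall i, 0 <= p`_i) -> p.[1] = 0 -> p = 0.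
Proof.
move=> p0; rewrite horner_coef => /eqP; rewrite psumr_eq0 => [/allP p1|i _]; last first.
  by rewrite expr1n mulr1.
apply/polyP => i; rewrite coef0; case: (ltnP i (size p)) => [lti|]; last exact: nth_default.
by have := p1 (Ordinal lti); rewrite mem_index_enum expr1n mulr1 /= => /(_ isT)/eqP.
Qed.

Lemma intr_eq_poly (dm : nat -> nat) (p : {poly int}) :
  (forall j, p`_j = (dm j)%:R) ->
  laurent_expansion (fun j => (dimZ dm j)%:R : rat) (Zt_Qt p).
Proof.
move=> pdm; rewrite /Zt_Qt -[_%:F]divr1 -tofrac1.
apply: (@laurent_of_series _ _ (fun j => (dm j)%:R)) => [//|//||k]; first exact: oner_neq0.
by rewrite -[X in psmul X _]/(1%:P) psmulC mul1r coef_map /= pdm mulrz_nat.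
Qed.

Lemma field_identity (L : fieldType) (x q d h r : L) : x != 0 -> d != 0 ->
  x^-1 * q + r + h / (x * d) = ((q * d + h) / x + d * r) / d.
Proof. by move=> x0 d0; field; rewrite x0 d0. Qed.

Lemma split_fraction (F : fieldType) (x : F) (p q d h r : {poly F}) :
  x != 0 -> d != 0 -> x *: p = q * d + h ->
  (x^-1 *: q + r)%:F + h%:F / (x%:P * d)%:F = (p + d * r)%:F / d%:F.
Proof.
move=> x0 d0 E.
have x0' : x%:P%:F != 0 :> {fraction {poly F}} by rewrite tofrac_eq0 polyC_eq0.
have d0' : d%:F != 0 :> {fraction {poly F}} by rewrite tofrac_eq0.
have xV : (x^-1)%:P%:F = (x%:P%:F)^-1 :> {fraction {poly F}}.
  by apply: (mulIf x0'); rewrite (mulVf x0') -tofracM -polyCM (mulVf x0) tofrac1.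
have pE : p%:F = (q%:F * d%:F + h%:F) / x%:P%:F :> {fraction {poly F}}.
  by rewrite -tofracM -tofracD -E -mul_polyC tofracM mulrC (mulKf x0').
rewrite -mul_polyC !tofracD !tofracM xV pE.
exact: field_identity x0' d0'.
Qed.

Section ArtinianForm.
Variables (dm : nat -> nat -> nat) (N : nat) (a : nat -> {poly int}).
Hypothesis dm_rational : forall n, rational_series (fun f : rat => f = 1) (fun j => (dm n j)%:R).
Hypothesis a_rational : rational_series admissible a.
Hypothesis a_dm : forall n j, (N <= n)%N -> (a n)`_j = (dm n j)%:R.

(** From width [N] on the coefficient is the polynomial [a n]; below [N] it is obtained from the
    rationality in fixed width. *)
Lemma hilbert_coefficients : exists H : nat -> Qt,
  (forall n, laurent_expansion (fun j => (dimZ (dm n) j)%:R : rat) (H n)) /\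
  (forall n, (N <= n)%N -> H n = Zt_Qt (a n)).
Proof.
suff ex n : exists x : Qt, laurent_expansion (fun j => (dimZ (dm n) j)%:R : rat) x /\
    ((N <= n)%N -> x = Zt_Qt (a n)).
  exists (fun n => epsilon (inhabits 0) (fun x : Qt =>
    laurent_expansion (fun j => (dimZ (dm n) j)%:R : rat) x /\
    ((N <= n)%N -> x = Zt_Qt (a n)))).
  by split=> n; have [] := epsilon_spec (inhabits 0) _ (ex n).
case: (leqP N n) => [leN|ltn].
  by exists (Zt_Qt (a n)); split=> //; apply: intr_eq_poly => j; apply: a_dm.
have [fs [p [_ Ep]]] := dm_rational n.
exists (p%:F / (geom_prod fs)%:F); split=> //.
apply: (@laurent_of_series _ _ (fun j => (dm n j)%:R)) => //.
by apply/eqP => D0; have /eqP := geom_prod_coef0 fs; rewrite D0 coef0 eq_sym oner_eq0.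
Qed.

Lemma artinian_hilbert_form :
  exists (b e : nat) (gt : {poly Qt}) (h : {poly {poly int}}) (f : 'I_b -> {poly int}),
    [/\ exists H : nat -> Qt,
          (forall n, laurent_expansion (fun j => (dimZ (dm n) j)%:R : rat) (H n)) /\
          laurent_expansion (fun k : int => if k is Posz n then H n else 0)
            (gt%:F + (Zst_Qts h)%:F /
              (((\prod_(j < b) Zt_Qt (f j)) ^+ e)%:P
              * \prod_(j < b) (1 - (Zt_Qt (f j))%:P * 'X))%:F),
        h = 0 \/ ~ (exists h' : {poly {poly int}}, h = (1 - 'X)%:P * h'),
        (size h <= b)%N
      & forall j, 0 < (f j).[1] /\ (f j).[0] = 1].
Proof.
have [fs [p [gfs Ep]]] := a_rational; have [H [Hdm Ha]] := hilbert_coefficients.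
set D := geom_prod fs in Ep *; pose F := \prod_(f <- fs) f.
have fs0 f : f \in fs -> f != 0.
  by case/gfs=> [f1 _]; apply: contraTneq f1 => ->; rewrite horner0 ltxx.
have [szD lcD] := geom_prod_lead fs0; rewrite -/D -/F in szD lcD.
have D0 : D != 0 by rewrite -size_poly_eq0 szD.
(* The leading coefficient of [D] is [F] up to sign, and scaling by [s] removes the sign from the
   pseudo-division identity. *)
pose e := scalp p D; pose s : {poly int} := ((-1) ^+ size fs) ^+ e.
have ss : s * s = 1 by rewrite -exprMn -exprMn mulrNN mulr1 !expr1n.
pose h := s *: (p %% D); pose Q := s *: (p %/ D).
have pE : F ^+ e *: p = Q * D + h.
  rewrite /Q /h -scalerAl -scalerDr -Pdiv.Idomain.divp_eq scalerA lcD exprMn -/s.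
  by rewrite mulrA ss mul1r.
have szh : (size h <= size fs)%N.
  by rewrite -ltnS -szD (leq_ltn_trans (size_scale_leq _ _)) // ltn_modp.
have F1 : 0 < F.[1].
  by rewrite horner_prod big_seq_cond; apply: prodr_gt0 => f /andP[/gfs[]].
have F0 : F != 0 by apply: contraTneq F1 => ->; rewrite horner0 ltxx.
have big_fs (R : Type) (idx : R) (op : R -> R -> R) (T : {poly int} -> R) :
    \big[op/idx]_(f <- fs) T f = \big[op/idx]_(j < size fs) T fs`_j.
  by rewrite (big_nth 0) big_mkord.
(* Correction at the widths below [N], where [H n] need not come from [a n]; it goes into the
   polynomial part in s. *)
pose delta := \poly_(n < N) (H n - Zt_Qt (a n)).
have HE n : H n = Zt_Qt (a n) + delta`_n.
  by rewrite coef_poly; case: ltnP => [_|/Ha->]; rewrite ?addr0 // addrC subrK.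
have phi0 : Zt_Qt (F ^+ e) != 0 by rewrite -(rmorph0 Zt_Qt) (inj_eq Zt_Qt_inj) expf_neq0.
have ZD0 : Zst_Qts D != 0.
  rewrite -(rmorph0 (map_poly Zt_Qt)) (inj_eq (map_inj_poly Zt_Qt_inj (rmorph0 _))) //.
exists (size fs), e, ((Zt_Qt (F ^+ e))^-1 *: Zst_Qts Q + delta), h, (fun j => fs`_j).
split=> //; last by move=> j; apply/gfs/mem_nth.
- exists H; split=> //.
  have -> : \prod_(j < size fs) Zt_Qt fs`_j = Zt_Qt F by rewrite rmorph_prod big_fs.
  have -> : \prod_(j < size fs) (1 - (Zt_Qt fs`_j)%:P * 'X) = Zst_Qts D.
    by rewrite Zst_Qts_geom_prod (big_fs _ _ _ (fun f => 1 - (Zt_Qt f)%:P * 'X)).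
  set R := (X in laurent_expansion _ X).
  have -> : R = (Zst_Qts p + Zst_Qts D * delta)%:F / (Zst_Qts D)%:F.
    rewrite /R -rmorphXn; apply: split_fraction => //.
    have := congr1 (map_poly Zt_Qt) pE.
    by rewrite map_polyZ rmorphD rmorphM.
  apply: (@laurent_of_series _ _ H) => // k.
  rewrite (eq_psmul _ HE) psmulDr coefD psmul_coef psmul_map Ep.
  by rewrite coef_map.
(* If 1 - t divides h, the series B = F^e a - Q satisfies D B = h and vanishes at t = 1. For large n
   this gives a_n(1) = 0, hence a_n = 0 as its coefficients are non-negative. So B is a polynomial
   in s, and comparing degrees in h = D B forces h = 0. *)
case: (classic (exists h' : {poly {poly int}}, h = (1 - 'X)%:P * h')) => [[h' Eh]|nh].
  left; pose ev := horner_eval (1 : int).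
  pose B n := F ^+ e * a n - Q`_n.
  have DB k : psmul D B k = h`_k.
    rewrite /psmul; under eq_bigr do rewrite mulrBr mulrCA.
    rewrite sumrB -mulr_sumr -/(psmul D a k) Ep -/(psmul D (fun i => Q`_i) k).
    by rewrite psmul_coef -coefZ pE coefD mulrC addrC addKr.
  have evB n : ev (B n) = 0.
    apply: (@psmul_inj _ (map_poly ev D) (fun n => ev (B n)) (fun=> 0)).
      apply/eqP => /(congr1 (fun q : {poly int} => q`_0)).
      have ev1 : ev 1 = 1 by rewrite /ev /horner_eval -[X in X.[1]]/(1%:P) hornerC.
      by rewrite coef_map geom_prod_coef0 coef0 -[LHS]/(ev 1) ev1 => /eqP; rewrite oner_eq0.
    move=> k; rewrite psmul_map DB Eh coefCM rmorphM /= /ev /horner_eval.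
    rewrite hornerD hornerN hornerX hornerC subrr mul0r /psmul big1 // => i _.
    by rewrite mulr0.
  pose n1 := maxn N (size Q).
  have B0 n : (n1 <= n)%N -> B n = 0.
    rewrite geq_max => /andP[leN leQ]; have Qn : Q`_n = 0 by rewrite nth_default.
    have := evB n; rewrite /B Qn subr0 /ev /horner_eval hornerM horner_exp => /eqP.
    rewrite mulf_eq0 expf_eq0 (gt_eqF F1) andbF /= => /eqP an1.
    rewrite (nonneg_horner1_eq0 _ an1) ?mulr0 // => i.
    by rewrite a_dm // ler0n.
  have hE : h = D * \poly_(n < n1) B n.
    apply/polyP => k; rewrite -DB -psmul_coef; apply: eq_psmul => n.
    by rewrite coef_poly; case: ltnP => // /B0.
  apply/eqP/negPn/negP => h0; have B1 : \poly_(n < n1) B n != 0.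
    by apply: contraNneq h0 => B1; rewrite hE B1 mulr0.
  move: szh; rewrite hE size_mul // szD addSn /= leqNgt -[X in (X < _)%N]addn0 ltn_add2l.
  by rewrite size_poly_gt0 B1.
by right.
Qed.

End ArtinianForm.

(** * From the form of the series back to bounded degrees *)

Lemma clear_denominator (L : fieldType) (p q g u : {poly L}) : q != 0 ->
  g%:F * (p%:F / q%:F) = u%:F -> g * p = u * q.
Proof.
move=> q0 E; apply/eqP; rewrite -tofrac_eq !tofracM -E.
by rewrite -mulrA divfK ?tofrac_eq0.
Qed.

Lemma geom_prod1_coprime (L : fieldType) (fs : seq L) (g : {poly L}) :
  (forall f, f \in fs -> f = 1) -> ~~ root g 1 -> coprimep (geom_prod fs) g.
Proof.
move=> fs1 g1; rewrite /geom_prod big_seq.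
apply: (big_ind (fun d => coprimep d g)) => [|d d' cd cd'|f /fs1 ->].
- exact: coprime1p.
- by rewrite coprimepMl cd.
rewrite scale1r -opprB -scaleN1r coprimepZl ?oppr_eq0 ?oner_eq0 // coprimep_sym.
by rewrite -[X in 'X - X]/(1%:P) coprimep_XsubC.
Qed.

(** The series has a power of 1 - t as a denominator, and also [g]. Since g(1) is nonzero the two
    are coprime, so the series is a polynomial. *)
Lemma bounded_of_integral (dm : nat -> nat) (x : Qt) (g u : {poly int}) :
  rational_series (fun f : rat => f = 1) (fun j => (dm j)%:R) ->
  laurent_expansion (fun j => (dimZ dm j)%:R : rat) x ->
  0 < g.[1] -> Zt_Qt g * x = Zt_Qt u ->
  exists E : nat, forall j, (E <= j)%N -> dm j = 0%N.
Proof.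
move=> [fs [P [fs1 EP]]] /series_of_laurent[] // p [q [q0 -> Ep]] g1.
rewrite /Zt_Qt; set g' := map_poly _ g; set u' := map_poly _ u.
move/(clear_denominator q0) => gp.
have gdm k : psmul g' (fun j => (dm j)%:R) k = u'`_k.
  move: k; apply: (psmul_inj q0) => k.
  rewrite -psmulA mulrC psmulA (eq_psmul _ Ep) !psmul_coef gp.
  by rewrite mulrC.
have gP : g' * P = geom_prod fs * u'.
  apply/polyP => k; rewrite -!psmul_coef -(eq_psmul _ gdm) -(eq_psmul _ EP).
  by rewrite -!psmulA mulrC.
have cop : coprimep (geom_prod fs) g'.
  apply: geom_prod1_coprime => //; rewrite rootE /g'.
  by rewrite -(rmorph1 (intr : int -> rat)) horner_map /= intr_eq0 gt_eqF.
have : geom_prod fs %| g' * P by rewrite gP dvdp_mulr.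
rewrite Gauss_dvdpr // => /dvdpP[w Pw].
have D0 : geom_prod fs != 0.
  by apply/eqP => D0; have /eqP := geom_prod_coef0 fs; rewrite D0 coef0 eq_sym oner_eq0.
exists (size w) => j lej; apply/eqP; rewrite -(eqr_nat rat).
have -> : (dm j)%:R = w`_j.
  by move: j {lej}; apply: (psmul_inj D0) => k; rewrite EP psmul_coef Pw mulrC.
by rewrite nth_default.
Qed.

Lemma add_fraction (L : fieldType) (x y z p q : {poly L}) : z != 0 -> q != 0 ->
  x%:F + y%:F / z%:F = p%:F / q%:F -> (x * z + y) * q = p * z.
Proof.
move=> z0 q0 E; apply: (fraction_eq z0 q0); rewrite -E tofracD tofracM mulrDl mulfK //.
by rewrite tofrac_eq0.
Qed.

Lemma hilbert_form_bounded (dm : nat -> nat -> nat) (H : nat -> Qt) (b e : nat)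
    (gt : {poly Qt}) (h : {poly {poly int}}) (f : 'I_b -> {poly int}) :
  (forall n, rational_series (fun f : rat => f = 1) (fun j => (dm n j)%:R)) ->
  (forall n, laurent_expansion (fun j => (dimZ (dm n) j)%:R : rat) (H n)) ->
  laurent_expansion (fun k : int => if k is Posz n then H n else 0)
    (gt%:F + (Zst_Qts h)%:F /
      (((\prod_(j < b) Zt_Qt (f j)) ^+ e)%:P
       * \prod_(j < b) (1 - (Zt_Qt (f j))%:P * 'X))%:F) ->
  (forall j, 0 < (f j).[1] /\ (f j).[0] = 1) ->
  forall n, (size gt <= n)%N -> exists E : nat, forall j, (E <= j)%N -> dm n j = 0%N.
Proof.
move=> dmR HL /series_of_laurent[] // p [q [q0 ER Ep]] fP n len.
have {}Ep k : psmul q H k = p`_k := Ep k.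
pose F := \prod_(j < b) f j; pose D := geom_prod [seq f j | j <- index_enum 'I_b].
have F1 : 0 < (F ^+ e).[1].
  by rewrite horner_exp exprn_gt0 // horner_prod prodr_gt0 // => j _; case: (fP j).
have F0 : Zt_Qt (F ^+ e) != 0.
  rewrite -(rmorph0 Zt_Qt) (inj_eq Zt_Qt_inj).
  by apply: contraTneq F1 => ->; rewrite horner0 ltxx.
have ZD0 : (Zst_Qts D)`_0 = 1 by rewrite coef_map geom_prod_coef0; apply: rmorph1.
have D0 : Zst_Qts D != 0.
  by apply/eqP => ZD; move/eqP: ZD0; rewrite ZD coef0 eq_sym oner_eq0.
have ED : \prod_(j < b) (1 - (Zt_Qt (f j))%:P * 'X) = Zst_Qts D.
  by rewrite Zst_Qts_geom_prod big_map.
have EF : (\prod_(j < b) Zt_Qt (f j)) ^+ e = Zt_Qt (F ^+ e).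
  by rewrite -rmorph_prod rmorphXn.
rewrite ED EF in ER; set c := (Zt_Qt (F ^+ e))%:P in ER.
have c0 : c != 0 by rewrite polyC_eq0.
have E := add_fraction (mulf_neq0 c0 D0) q0 ER.
have HE k : psmul (c * Zst_Qts D) H k = (gt * (c * Zst_Qts D) + Zst_Qts h)`_k.
  move: k; apply: (psmul_inj q0) => k; rewrite psmul_coef [q * _]mulrC E.
  by rewrite -psmulA mulrC psmulA (eq_psmul _ Ep) psmul_coef mulrC.
(* Subtracting the polynomial part and clearing F^e leaves a series [S] with D S = h. *)
pose S n := Zt_Qt (F ^+ e) * (H n - gt`_n).
have SE k : psmul (Zst_Qts D) S k = (Zst_Qts h)`_k.
  have -> : psmul (Zst_Qts D) S k = psmul (c * Zst_Qts D) (fun n => H n + (- gt)`_n) k.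
    by rewrite mulrC psmulA; apply: eq_psmul => m; rewrite psmulC coefN.
  by rewrite psmulDr HE psmul_coef mulrN coefD coefN [gt * _]mulrC addrAC subrr add0r.
(* [D] has constant coefficient 1 in s, so D S = h determines each [S k] from the earlier ones
   without division, inside Z[t]. *)
have [u Eu] : exists u, S n = Zt_Qt u.
  have {len} : forall n, exists u, S n = Zt_Qt u; last by apply.
  elim/ltn_ind => k IHk; have := SE k.
  rewrite /psmul big_ord_recl /= ZD0 mul1r subn0 => /eqP; rewrite -subr_eq0 -addrA.
  rewrite addr_eq0 => /eqP ->.
  pose ran x := exists u, x = Zt_Qt u.
  have ranD x y : ran x -> ran y -> ran (x + y).
    by move=> [v ->] [w ->]; exists (v + w); rewrite rmorphD.
  have ranN x : ran x -> ran (- x) by move=> [v ->]; exists (- v); rewrite rmorphN.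
  apply: (ranN _); apply: (ranD _ _); last by apply: (ranN _); rewrite coef_map; exists h`_k.
  apply: (big_ind ran) => [||i _]; [by exists 0; rewrite rmorph0 | exact: ranD |].
  have [|v ->] := IHk (k - bump 0 i)%N; first by rewrite ltn_subrL (leq_trans _ (ltn_ord i)).
  by rewrite coef_map; exists (D`_(bump 0 i) * v); rewrite rmorphM.
(* Beyond the size of [gt], [S n] is F^e times [H n]. *)
apply: (bounded_of_integral (dmR n) (HL n) F1 (u := u)).
by rewrite -Eu /S nth_default // subr0.
Qed.

(** * Equivalence of the Artinian property and the form of the series *)

Theorem theorem6p3 (K : fieldType) (c : nat) (hc : (1 <= c)%N) (X : OI_or_FI)
    (M : fmodule K c X) (G : grading M)
    (hfg : finitely_generated M) (hnn : generated_nonneg G) :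
  artinian M <->
  exists (b e : nat) (gt : {poly Qt}) (h : {poly {poly int}})
         (f : 'I_b -> {poly int}),
    [/\ equivariant_hilbert_series G
          (gt%:F + (Zst_Qts h)%:F /
             (((\prod_(j < b) Zt_Qt (f j)) ^+ e)%:P
              * \prod_(j < b) (1 - (Zt_Qt (f j))%:P * 'X))%:F),
        h = 0 \/ ~ (exists h' : {poly {poly int}}, h = (1 - 'X)%:P * h'),
        (size h <= b)%N
      & forall j, 0 < (f j).[1] /\ (f j).[0] = 1].
Proof.
have [r [d [g [dg [g_hom g_span]]]]] := OI_generators hfg hnn.
have [dm dmP] : exists dm : nat -> nat -> nat, forall n,
    (forall j : nat, has_dim (@gcomp _ _ _ _ G n j%:Z) (dm n j)) /\
    rational_series (fun f : rat => f = 1) (fun j => (dm n j)%:R).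
  exists (fun n => epsilon (inhabits (fun=> 0%N)) (fun dm : nat -> nat =>
    (forall j : nat, has_dim (@gcomp _ _ _ _ G n j%:Z) (dm j)) /\
    rational_series (fun f : rat => f = 1) (fun j => (dm j)%:R))) => n.
  exact: (epsilon_spec (inhabits _) _ (fixed_width_rational g_hom g_span n)).
have neg n j : j < 0 -> forall q : M n, gcomp G j q -> q = 0.
  by move=> j0 q; apply: (gcomp_neg g_hom g_span).
have dimP n j : has_dim (@gcomp _ _ _ _ G n j) (dimZ (dm n) j).
  case: j => j; first by have [] := dmP n.
  exists (fun=> 0); split=> [[]//|q /neg->//|a _ []//].
  by exists (fun=> 0); rewrite big_ord0.
split=> [[n0 art]|[b [e [gt [h [f [[dim [H [hd HL HR]]] _ _ fP]]]]]]].
  (* [N >= n0] makes M_N Artinian, hence bounded in degree; [N] also exceeds the width of every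
     generator, which leaves unmarked letters to erase in longer words. *)
  pose N := maxn n0 (\max_k d k).+1.
  have ltdN k : (d k < N)%N by rewrite leq_max ltnS (leq_bigmax k) orbT.
  have [E bounded] := artinian_bounded G (art N (leq_maxl _ _)).
  have a_dm n j : (N <= n)%N -> (std_series g dg E n)`_j = (dm n j)%:R.
    move=> /(std_series_dim g_hom g_span ltdN bounded j)[e' he ->].
    by congr _%:R; exact: (@kdim_uniq K (kres (M n)) _ _ _ he (proj1 (dmP n) j)).
  have [b [e [gt [h [f [[H [HL HR]] h0 szh fP]]]]]] :=
    artinian_hilbert_form (fun n => proj2 (dmP n)) (std_series_rational g dg E) a_dm.
  by exists b, e, gt, h, f; split=> //; exists (fun n => dimZ (dm n)), H.
(* Dimensions are unique, so the given dimension function is the one already known to be rational in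
   each width. *)
have Edim : dim = fun n => dimZ (dm n).
  apply: functional_extensionality => n; apply: functional_extensionality => j.
  exact: (@kdim_uniq K (kres (M n)) _ _ _ (hd n j) (dimP n j)).
rewrite Edim in HL; exists (size gt) => n len.
have [E dE] := hilbert_form_bounded (fun n => proj2 (dmP n)) HL HR fP len.
exact: (bounded_artinian (@neg n) (proj1 (dmP n)) dE).
Qed.
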